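(* Let $\mathcal{BT}$ be the class of complete binary trees. Then $\chi_{rs}(\mathcal{BT})=\infty$; that is, $\mathcal{BT}$ is rainbow separable, but $r_k(\mathcal{BT})\ne 1$ for every finite $k\ge 2$.
   Context: All graphs are finite and simple. A (rooted) binary tree is full if its root has degree $2$ and every other non-leaf vertex has degree $3$; a full binary tree is complete if every leaf has the same distance from the root (so it has $n=2^r-1$ vertices for some $r$). Let $G$ be a graph and $k\ge 2$ an integer. A multiset $\mathscr{P}$ of paths in $G$ is a $k$-rainbow separating path system ($k$-RSPS) if its elements can be colored with (at most) $k$ colors so that for every pair of distinct edges $e_1,e_2\in E(G)$ there exist paths $P_1,P_2\in\mathscr{P}$ of distinct colors such that $P_1$ contains $e_1$ but not $e_2$, and $P_2$ contains $e_2$ but not $e_1$. The $k$-rainbow separation number $c_k(G)$ is the smallest cardinality (with multiplicity) of a $k$-RSPS of $G$. Write $c_\infty(G)$ for the strong separation number of $G$: the least size of a set of paths of $G$ such that for every ordered pair $(e,f)$ of distinct edges some path in the set contains $e$ and avoids $f$. For $k\in\{2,3,\dots\}\cup\{\infty\}$ the $k$-rainbow separation ratio of $G$ (with at least two edges) is $r_k(G)=c_k(G)/c_\infty(G)$. For a class (infinite family) $\Sigma$ of graphs, $r_k(\Sigma)=\limsup_{G\in\Sigma} r_k(G)$, the limsup being taken as $|V(G)|\to\infty$ over $G\in\Sigma$. The class $\Sigma$ is rainbow separable if for every $\varepsilon>0$ there exists a finite $k$ with $r_k(\Sigma)<1+\varepsilon$; in that case its chromatic separation number is $\chi_{rs}(\Sigma)=\min\{k\in\{2,3,\dots\}\cup\{\infty\}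 : r_k(\Sigma)=1\}$. *)

(* Defs.v *)
From mathcomp Require Import all_boot all_order all_algebra.
From mathcomp Require Import all_classical all_reals all_analysis.

Set Implicit Arguments.
Unset Strict Implicit.
Unset Printing Implicit Defensive.

Import Order.TTheory GRing.Theory Num.Theory.

Local Open Scope classical_set_scope.
Local Open Scope nat_scope.

(* The minimum of a set of natural numbers; the value 0 on the empty set is
   junk, and never used for [sep_number] below (see [strong_sep_exists] and
   [rsps_exists]). *)
Definition least (P : set nat) : nat :=
  xget 0 [set n | P n /\ forall m, P m -> n <= m].

Lemma leastP (P : set nat) :
  (exists n, P n) -> P (least P) /\ forall m, P m -> least P <= m.
Proof.
move=> exP; suff exmin : exists n, P n /\ forall m, P m -> n <= m.
  exact: (xgetPex 0 exmin).
have exb : exists n, `[< P n >] by case: exP => n Pn; exists n; apply/asboolP.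
case: (ex_minnP exb) => n /asboolP Pn nmin; exists n; split=> // m Pm.
by apply: nmin; apply/asboolP.
Qed.

Record sgraph := SGraph {
  vertex :> finType;
  adj : rel vertex;
  adj_sym : symmetric adj;
  adj_irrefl : irreflexive adj }.

Definition edges (G : sgraph) : {set {set G}} :=
  [set [set u.1; u.2] | u : G * G & adj u.1 u.2]%SET.

Definition deg (G : sgraph) (x : G) : nat := #|[set y | adj x y]%SET|.

Definition dist (G : sgraph) (x y : G) : nat :=
  least [set n | exists p : seq G, [/\ path (@adj G) x p, last x p = y & size p = n]].

(* A path is a subgraph, i.e. the pair of its vertex set and its edge set, so
   that a vertex sequence and its reversal give the same path. *)
Definition subgraph (G : sgraph) : finType := ({set G} * {set {set G}})%type.

Definition path_subgraph (G : sgraph) (p : seq G) : subgraph G :=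
  ([set x in p]%SET, [set [set u.1; u.2] | u in zip p (behead p)]%SET).

Definition is_path (G : sgraph) (P : subgraph G) : Prop :=
  exists x p, [/\ path (@adj G) x p, uniq (x :: p) & P = path_subgraph (x :: p)].

Definition contains_edge (G : sgraph) (P : subgraph G) (e : {set G}) : bool :=
  e \in P.2.

(* A multiset of n paths is given as a family indexed by 'I_n, so that repeated
   paths may receive different colors. *)
Definition is_rsps (G : sgraph) (k n : nat) (P : 'I_n -> subgraph G) : Prop :=
  (forall i, is_path (P i)) /\
  exists col : 'I_n -> 'I_k,
    forall e1 e2 : {set G}, e1 \in edges G -> e2 \in edges G -> e1 <> e2 ->
    exists i j : 'I_n,
      [/\ col i <> col j,
          contains_edge (P i) e1 /\ ~~ contains_edge (P i) e2 &
          contains_edge (P j) e2 /\ ~~ contains_edge (P j) e1].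

Definition is_strong_sep (G : sgraph) (S : {set subgraph G}) : Prop :=
  (forall P, P \in S -> is_path P) /\
  forall e f : {set G}, e \in edges G -> f \in edges G -> e <> f ->
  exists P, [/\ P \in S, contains_edge P e & ~~ contains_edge P f].

(* Elements of {2, 3, ...} \cup {oo}: [Some k] is the integer k, [None] is oo. *)
Definition ecolor := option nat.

Definition ecolor_ok (k : ecolor) : bool := if k is Some n then 2 <= n else true.

Definition ecolor_le (k l : ecolor) : bool :=
  match k, l with
  | _, None => true
  | None, Some _ => false
  | Some m, Some n => m <= n
  end.

Definition sep_number (k : ecolor) (G : sgraph) : nat :=
  match k with
  | Some k => least [set n | exists P : 'I_n -> subgraph G, is_rsps k P]
  | None => least [set n | exists S : {set subgraph G}, is_strong_sep S /\ #|S| = n]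
  end.

Definition sep_ratio (R : realType) (k : ecolor) (G : sgraph) : R :=
  ((sep_number k G)%:R / (sep_number None G)%:R)%R.

(* limsup of r_k(G) over G in Sigma as |V(G)| tends to infinity *)
Definition class_ratio (R : realType) (k : ecolor) (Sigma : sgraph -> Prop) : \bar R :=
  ereal_inf [set ereal_sup [set x : \bar R | exists G : sgraph,
      [/\ Sigma G, 2 <= #|edges G|, n <= #|G| & x = (sep_ratio R k G)%:E]]
    | n in [set: nat]].

Definition rainbow_separable (R : realType) (Sigma : sgraph -> Prop) : Prop :=
  forall eps : R, (0 < eps)%R ->
  exists k : nat, 2 <= k /\ (class_ratio R (Some k) Sigma < (1 + eps)%:E)%E.

(* The default value [Some 0] is not admissible, so it cannot be mistaken for an
   actual minimum. *)
Definition chi_rs (R : realType) (Sigma : sgraph -> Prop) : ecolor :=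
  xget (Some 0)
    [set k | [/\ ecolor_ok k, class_ratio R k Sigma = 1%E &
      forall l, ecolor_ok l -> class_ratio R l Sigma = 1%E -> ecolor_le k l]].

Definition is_tree (G : sgraph) : Prop :=
  [/\ 0 < #|G|, forall x y : G, connect (@adj G) x y &
      forall c : seq G, 2 < size c -> ~ ucycle (@adj G) c].

Definition leaf (G : sgraph) (x : G) : bool := deg x == 1.

Definition full_binary_tree (G : sgraph) (r : G) : Prop :=
  [/\ is_tree G, deg r = 2 & forall x : G, x <> r -> ~~ leaf x -> deg x = 3].

Definition complete_binary_tree (G : sgraph) : Prop :=
  exists r : G, full_binary_tree r /\
    exists d : nat, forall x : G, leaf x -> dist r x = d.

Definition BT : sgraph -> Prop := complete_binary_tree.

Lemma edge_path (G : sgraph) (e : {set G}) : e \in edges G ->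
  exists P : subgraph G, is_path P /\ forall f, contains_edge P f = (f == e).
Proof.
case/imsetP => -[x y]; rewrite inE /= => xy ->.
exists (path_subgraph [:: x; y]); split.
  exists x, [:: y]; split=> //=; first by rewrite xy.
  by rewrite inE andbT; apply: contraTneq xy => ->; rewrite adj_irrefl.
move=> f; rewrite /contains_edge /=; apply/imsetP/eqP => [[u]|->].
  by rewrite inE => /eqP -> /= ->.
by exists (x, y); rewrite ?inE.
Qed.

Lemma strong_sep_exists (G : sgraph) :
  exists n, exists S : {set subgraph G}, is_strong_sep S /\ #|S| = n.
Proof.
pose S := [set P : subgraph G | `[< is_path P >]]%SET.
exists #|S|, S; split=> //; split=> [P|e f eG _ ef].
  by rewrite inE => /asboolP.
have [P [pP Pe]] := edge_path eG; exists P; rewrite !Pe inE eqxx.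
by split=> //; [apply/asboolP | apply/eqP => fe; apply: ef].
Qed.

Lemma rsps_exists (G : sgraph) (k : nat) : 2 <= k ->
  exists n, exists P : 'I_n -> subgraph G, is_rsps k P.
Proof.
case: k => [|[|k]] // _.
pose S := [set P : subgraph G | `[< is_path P >]]%SET.
pose I : finType := ({P : subgraph G | P \in S} * 'I_k.+2)%type.
exists #|I|, (fun i => val (enum_val i : I).1); split=> [i|].
  by have := valP (enum_val i : I).1; rewrite inE => /asboolP.
exists (fun i => (enum_val i : I).2) => e1 e2 e1G e2G ne.
have [P1 [p1 P1e]] := edge_path e1G; have [P2 [p2 P2e]] := edge_path e2G.
have s1 : P1 \in S by rewrite inE; apply/asboolP.
have s2 : P2 \in S by rewrite inE; apply/asboolP.
exists (enum_rank ((exist _ P1 s1, ord0) : I)).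
exists (enum_rank ((exist _ P2 s2, ord_max) : I)).
rewrite !enum_rankK /= !P1e !P2e !eqxx; split=> //; split=> //.
- by apply/eqP => e; apply: ne.
- exact/eqP.
Qed.

(* Main.v *)
Require Import Defs.
From mathcomp Require Import all_boot all_order all_algebra.
From mathcomp Require Import all_classical all_reals all_analysis.
From mathcomp Require Import zify lra.

Set Implicit Arguments.
Unset Strict Implicit.
Unset Printing Implicit Defensive.

Import Order.TTheory GRing.Theory Num.Theory.
Local Open Scope nat_scope.

(** Let T be the complete binary tree of height h; it has L = 2^h leaves, and all
    bounds below are compared with L. Every complete binary tree is isomorphic to
    such a tree of bit strings ([BT_iso]), so it is enough to study these.

    The strong separation number is at least L ([strong_sep_card]): a leaf edge that
    lies on a single path is that whole path, any other leaf edge lies on two paths,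
    and a path has two ends only.

    Rainbow separability ([sep_number_bintree_le]). For every inner vertex v there is
    a zigzag path that turns at v and runs down to a leaf on both sides; almost all
    edges are the intersection of two of these paths. Cut the tree at height D above
    the leaves, into blocks that are trees of height D. The zigzag paths that turn at
    a vertex of a block stay in the block; give them distinct colours, with the same
    palette in all blocks. Edges in one block are then separated by different, hence
    differently coloured, paths, and edges in different blocks are separated because
    each of them lies on two zigzag paths of different colours. The few edges to which
    this does not apply, those above the blocks and those on the two constant runs from
    the root of a block, receive two single-edge paths in two further colours. There
    are fewer than L zigzag paths and O(D 2^(h-D)) single-edge paths. So the number of
    paths is L (1 + O(D / 2^D)), while the number of colours depends on D alone.

    No fixed number k of colours suffices ([rainbow_card]). For each colour, at most
    one edge has all its paths in that colour. Consider a subtree of height k at the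
    bottom of the tree without such edges, in which every leaf edge lies on exactly
    two paths and no path ends at an inner vertex. By induction from the leaves, every
    edge of the subtree lies on at most two paths. A path through an edge just below
    the root of the subtree must run down to a leaf, through k edges. If two edges lie
    on a common path, they can be separated only by their other two paths, so these k
    other paths have different colours; none of them has the colour of the common
    path. This needs k + 1 colours. So each of the 2^(h-k) subtrees has a
    monochromatic edge, a third path through a leaf edge, or an end of a path at an
    inner vertex. Counting ends shows that at least L (1 + 2^-(k+1)) - O(k) paths are
    needed. The strong separation number, however, is L (1 + o(1)), since it is at
    most any rainbow separation number. *)

(** * Edges of a path *)

Section Edges.
Variable G : sgraph.
Implicit Types (x y z : G) (p q : seq G) (e : {set G}).

Lemma edgesP e :
  reflect (exists x y, adj x y /\ e = [set x; y]%SET) (e \in edges G).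
Proof.
apply: (iffP imsetP) => [[[x y]]|[x [y [xy ->]]]].
  by rewrite inE /= => xy ->; exists x, y.
by exists (x, y); rewrite ?inE.
Qed.

Lemma contains_edgeP p e :
  reflect (exists u v, (u, v) \in zip p (behead p) /\ e = [set u; v]%SET)
          (contains_edge (path_subgraph p) e).
Proof.
apply: (iffP imsetP) => [[[u v]]|[u [v [uv ->]]]].
  by move=> /= uv ->; exists u, v.
by exists (u, v).
Qed.

Lemma contains_edge_sing x e : contains_edge (path_subgraph [:: x]) e = false.
Proof. by apply/negP => /contains_edgeP [u [v []]]. Qed.

Lemma contains_edge_cons x y p e :
  contains_edge (path_subgraph [:: x, y & p]) e =
  (e == [set x; y]%SET) || contains_edge (path_subgraph (y :: p)) e.
Proof.
apply/contains_edgeP/orP => [[u [v [/= ]]]|[/eqP ->|]].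
- rewrite inE => /orP[/eqP[-> ->] ->|uv ->]; [by left; rewrite eqxx|right].
  by apply/contains_edgeP; exists u, v.
- by exists x, y; rewrite /= inE eqxx.
- by case/contains_edgeP=> u [v [uv ->]]; exists u, v; rewrite /= inE uv orbT.
Qed.

Lemma contains_edge_cat p x q e :
  contains_edge (path_subgraph (p ++ x :: q)) e =
  contains_edge (path_subgraph (rcons p x)) e
  || contains_edge (path_subgraph (x :: q)) e.
Proof.
elim: p => [|y p IHp] /=; first by rewrite contains_edge_sing.
case: p IHp => [|z p] /= IHp.
  by rewrite !contains_edge_cons contains_edge_sing orbF.
by rewrite !contains_edge_cons IHp orbA.
Qed.

Lemma contains_edge_rcons p x y e :
  contains_edge (path_subgraph (rcons (rcons p x) y)) e =
  contains_edge (path_subgraph (rcons p x)) e || (e == [set x; y]%SET).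
Proof.
rewrite -cats1 cat_rcons contains_edge_cat.
by rewrite contains_edge_cons contains_edge_sing orbF.
Qed.

Lemma contains_edge_rev p e :
  contains_edge (path_subgraph (rev p)) e = contains_edge (path_subgraph p) e.
Proof.
elim: p => // x [|y p] IHp //.
rewrite rev_cons in IHp.
by rewrite !rev_cons contains_edge_rcons IHp contains_edge_cons finset.setUC orbC.
Qed.

Lemma contains_edge_mem p e x :
  contains_edge (path_subgraph p) e -> x \in e -> x \in p.
Proof.
elim: p => [|y [|z p] IHp]; first by case/contains_edgeP=> ? [? []].
  by rewrite contains_edge_sing.
rewrite contains_edge_cons => /orP[/eqP-> /set2P[] ->|Pe xe].
- exact: mem_head.
- by rewrite !inE eqxx orbT.
- by rewrite inE IHp ?orbT.
Qed.

Lemma path_contains_edge_edges (P : subgraph G) e :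
  is_path P -> contains_edge P e -> e \in edges G.
Proof.
move=> [x [p [xp _ ->]]].
elim: p x xp => [|y p IHp] x /=; first by rewrite contains_edge_sing.
case/andP=> xy yp; rewrite contains_edge_cons => /orP[/eqP->|]; last exact: IHp.
by apply/edgesP; exists x, y.
Qed.
End Edges.

(** * Isomorphic graphs have the same separation numbers *)

Definition graph_iso (G H : sgraph) (f : G -> H) : Prop :=
  bijective f /\ forall x y, adj (f x) (f y) = adj x y.

Definition map_subgraph (G H : sgraph) (f : G -> H) (P : subgraph G) :
    subgraph H :=
  (f @: P.1, (fun e : {set G} => f @: e) @: P.2)%SET.

Section GraphIso.
Variables (G H : sgraph) (f : G -> H).
Hypothesis isof : graph_iso f.

Let f_inj : injective f. Proof. by have [[g fK _] _] := isof; apply: can_inj fK. Qed.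

Lemma graph_iso_sym : exists g : H -> G, graph_iso g.
Proof.
have [[g fK gK] fadj] := isof; exists g; split; first by exists f.
by move=> x y; rewrite -fadj !gK.
Qed.

Lemma map_path_subgraph p :
  map_subgraph f (path_subgraph p) = path_subgraph (map f p).
Proof.
rewrite /map_subgraph /path_subgraph /=; congr pair.
  apply/setP => y; rewrite inE; apply/imsetP/mapP => -[x xp ->]; exists x => //.
    by rewrite inE in xp.
  by rewrite inE.
have -> : zip (map f p) (behead (map f p)) =
    [seq (f u.1, f u.2) | u <- zip p (behead p)].
  rewrite behead_map; move: (behead p) => q.
  by elim: p q => [|x p IHp] [|y q] //=; rewrite IHp.
rewrite -imset_comp; apply/setP => e.
apply/imsetP/imsetP => -[u up ->] /=.
  exists (f u.1, f u.2) => /=; last by rewrite imsetU1 imset_set1.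
  by apply/mapP; exists u.
case/mapP: up => v vp -> /=; exists v => //; by rewrite imsetU1 imset_set1.
Qed.

Lemma map_is_path P : is_path P -> is_path (map_subgraph f P).
Proof.
case=> x [p [xp up ->]]; exists (f x), (map f p); split.
- by rewrite path_map (eq_path (e' := @adj G)) //; case: isof.
- by rewrite -map_cons map_inj_uniq.
- by rewrite map_path_subgraph.
Qed.

Lemma map_contains_edge P (e : {set G}) :
  contains_edge (map_subgraph f P) (f @: e)%SET = contains_edge P e.
Proof. by rewrite /contains_edge /= mem_imset //; apply: imset_inj. Qed.

Lemma edges_iso (e : {set H}) :
  e \in edges H -> exists2 e' : {set G}, e' \in edges G & e = (f @: e')%SET.
Proof.
have [[g fK gK] fadj] := isof.
case/edgesP=> x [y [xy ->]]; exists [set g x; g y]%SET.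
  by apply/edgesP; exists (g x), (g y); rewrite -fadj !gK.
by rewrite imsetU1 imset_set1 !gK.
Qed.

Lemma map_subgraph_inj : injective (map_subgraph f).
Proof.
move=> [V E] [V' E'] [] /(imset_inj f_inj) -> .
by move/(imset_inj (imset_inj f_inj)) ->.
Qed.

Lemma map_rsps k n (P : 'I_n -> subgraph G) :
  is_rsps k P -> is_rsps k (fun i => map_subgraph f (P i)).
Proof.
case=> pP [col sepP]; split=> [i|]; first exact: map_is_path.
exists col => _ _ /edges_iso[e1 e1G ->] /edges_iso[e2 e2G ->] ne.
have e12 : e1 <> e2 by move=> e; apply: ne; rewrite e.
have [i [j cP]] := sepP e1 e2 e1G e2G e12.
by exists i, j; rewrite !map_contains_edge.
Qed.

Lemma map_strong_sep (S : {set subgraph G}) :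
  is_strong_sep S -> is_strong_sep (map_subgraph f @: S)%SET.
Proof.
case=> pS sepS; split=> [_ /imsetP[P PS ->]|]; first exact/map_is_path/pS.
move=> _ _ /edges_iso[e1 e1G ->] /edges_iso[e2 e2G ->] ne.
have e12 : e1 <> e2 by move=> e; apply: ne; rewrite e.
have [P [PS Pe1 Pe2]] := sepS e1 e2 e1G e2G e12.
exists (map_subgraph f P); rewrite !map_contains_edge; split=> //.
exact: imset_f.
Qed.
End GraphIso.

Lemma sep_number_iso (G H : sgraph) (f : G -> H) k :
  graph_iso f -> sep_number k G = sep_number k H.
Proof.
move=> isof; have [g isog] := graph_iso_sym isof.
case: k => [k|]; rewrite /sep_number; congr least; apply/seteqP; split=> n /=.
- by case=> P rP; eexists; apply: map_rsps isof _ _ _ rP.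
- by case=> P rP; eexists; apply: map_rsps isog _ _ _ rP.
- case=> S [sS <-]; exists (map_subgraph f @: S)%SET.
  by split; [apply: map_strong_sep | rewrite card_imset //; apply: map_subgraph_inj].
- case=> S [sS <-]; exists (map_subgraph g @: S)%SET.
  by split; [apply: map_strong_sep | rewrite card_imset //; apply: map_subgraph_inj].
Qed.

Lemma card_iso (G H : sgraph) (f : G -> H) : graph_iso f -> #|G| = #|H|.
Proof. by case=> /bij_eq_card. Qed.

(** * Acyclic graphs *)

Lemma least_eq (A : set nat) n :
  A n -> (forall m, A m -> n <= m) -> least A = n.
Proof.
move=> An nmin; have [Al lmin] := leastP (ex_intro A n An).
by apply/eqP; rewrite eqn_leq lmin // nmin.
Qed.

Section Acyclic.
Variable G : sgraph.
Hypothesis acyclic : forall c : seq G, 2 < size c -> ~ ucycle (@adj G) c.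

(** If the two paths leave x by different neighbours y and z, then y and z are joined
    by a path that avoids x, and this path closes a cycle through x. *)
Lemma simple_path_unique (x : G) p q :
  path (@adj G) x p -> uniq (x :: p) -> path (@adj G) x q -> uniq (x :: q) ->
  last x p = last x q -> p = q.
Proof.
elim: p x q => [|y p IHp] x [|z q] //=.
- by move=> _ _ _ /andP[xq _] xl; move: xq; rewrite xl mem_last.
- by move=> _ /andP[xp _] _ _ xl; move: xp; rewrite -xl mem_last.
move=> /andP[xy yp] /andP[xyp uyp] /andP[xz zq] /andP[xzq uzq] lpq.
case: (eqVneq y z) => [yz|yz].
  by move: zq uzq lpq; rewrite -yz => yq uyq lpq; rewrite (IHp y q).
pose e := [rel a b : G | [&& adj a b, a != x & b != x]].
have sub a s : path (@adj G) a s -> x \notin a :: s -> path e a s.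
  elim: s a => //= b s IHs a /andP[ab bs]; rewrite inE negb_or => /andP[xa xbs].
  rewrite IHs // ab andbT /= eq_sym xa.
  by move: xbs; rewrite inE negb_or eq_sym => /andP[-> _].
have syme : connect_sym e.
  by apply: sym_connect_sym => a b /=; rewrite adj_sym andbA andbAC -andbA.
have : connect e y z.
  apply: (@connect_trans _ _ (last y p)).
    by apply/connectP; exists p => //; apply: sub.
  by rewrite syme lpq; apply/connectP; exists q => //; apply: sub.
case/connectP=> s0 /shortenP[s es us _] zl.
exfalso; apply: (@acyclic (x :: y :: s)).
  by case: (s) zl => [|//] zy; rewrite zy eqxx in yz.
have xs : x \notin s.
  elim: s y es {yz us zl xyp lpq uyp IHp yp xy} => //= b s IHs a /andP[/and3P[_ _ bx]].
  by rewrite inE negb_or eq_sym bx => /IHs.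
move: us => /= us; rewrite /ucycle /= xy rcons_path -zl adj_sym xz andbT us andbT.
rewrite inE negb_or xs andbT; apply/andP; split.
  by apply: sub_path es => a b /and3P[].
by move: xyp; rewrite inE negb_or => /andP[].
Qed.

Section Levels.
Variable r : G.
Hypothesis conn : forall x : G, connect (@adj G) r x.

(** A shortest walk contains a simple path, which is the only one. *)
Lemma simple_path_exists (x : G) : exists p,
  [/\ path (@adj G) r p, uniq (r :: p), last r p = x & size p = dist r x].
Proof.
have /connectP[p0 /shortenP[p rp up _] xp] := conn x.
exists p; split=> //; rewrite /dist; apply/esym/least_eq; first by exists p.
move=> m [q [rq qx <-]]; case: (shortenP rq) qx => q' rq' uq' sq qx.
rewrite (simple_path_unique rp up rq' uq') ?qx //.
by apply: uniq_leq_size sq; case/andP: uq'.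
Qed.

Lemma dist_simple_path p :
  path (@adj G) r p -> uniq (r :: p) -> dist r (last r p) = size p.
Proof.
move=> rp up; have [q [rq uq pq <-]] := simple_path_exists (last r p).
by rewrite (simple_path_unique rp up rq uq).
Qed.

(** Prolonging the simple path to x by a neighbour y gives the simple path to y,
    unless y is already on it, and then y comes just before x. *)
Lemma dist_adj (x y : G) : adj x y ->
  (forall p, path (@adj G) r p -> uniq (r :: p) -> last r p = x ->
     uniq (r :: rcons p y) /\ dist r y = (dist r x).+1)
  \/ dist r x = (dist r y).+1.
Proof.
move=> xy; have [p [rp up px dx]] := simple_path_exists x.
case: (boolP (y \in r :: p)) => yp; last first.
  left=> q rq uq qx; rewrite (simple_path_unique rq uq rp up) ?qx //.
  have uy : uniq (r :: rcons p y) by rewrite -rcons_cons rcons_uniq yp.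
  split=> //; rewrite -dx -(size_rcons p y) -dist_simple_path ?last_rcons //.
  by rewrite rcons_path rp px.
right; case/splitPl: p / yp rp up px dx => p1 p2 p1y.
rewrite cat_path -cat_cons cat_uniq last_cat p1y => /andP[rp1 yp2].
case/and3P=> up1 p12 up2 p2x dx.
have xp1 : x \notin r :: p1.
  apply: contraL xy; rewrite -p2x => lp1.
  case/lastP: p2 {yp2 up2 dx p2x} p12 lp1 => [|p2 a] /=; first by rewrite adj_irrefl.
  by rewrite last_rcons has_rcons => /norP[/negbTE->].
have rp1x : path (@adj G) r (rcons p1 x) by rewrite rcons_path rp1 p1y adj_sym.
have up1x : uniq (r :: rcons p1 x) by rewrite -rcons_cons rcons_uniq xp1.
have := dist_simple_path rp1x up1x; rewrite last_rcons size_rcons => ->.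
by rewrite -p1y dist_simple_path.
Qed.

Lemma dist_adjS (x y : G) :
  adj x y -> dist r y = (dist r x).+1 \/ dist r x = (dist r y).+1.
Proof.
move=> xy; have [p [rp up px _]] := simple_path_exists x.
by case: (dist_adj xy) => [/(_ p rp up px)[]|]; auto.
Qed.

Lemma dist_root : dist r r = 0.
Proof. exact: (@dist_simple_path [::]). Qed.

(** Two neighbours of x that are closer to r would give two simple paths to x. *)
Lemma parent_unique (x y z : G) : adj y x -> adj z x ->
  dist r x = (dist r y).+1 -> dist r x = (dist r z).+1 -> y = z.
Proof.
move=> yx zx xy xz.
have [p [rp up py _]] := simple_path_exists y.
have [q [rq uq qz _]] := simple_path_exists z.
have pred a : dist r x = (dist r a).+1 -> dist r a <> (dist r x).+1.
  by move=> -> /eqP; rewrite -addn2 -[X in X == _]addn0 eqn_add2l.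
case: (dist_adj yx) => [/(_ p rp up py)[upx _]|/(pred _ xy)//].
case: (dist_adj zx) => [/(_ q rq uq qz)[uqx _]|/(pred _ xz)//].
have pqx : rcons p x = rcons q x.
  apply: (@simple_path_unique r) => //; rewrite ?last_rcons // rcons_path.
  - by rewrite rp py.
  - by rewrite rq qz.
by rewrite -py -qz (@rcons_injl _ x _ _ pqx).
Qed.

Lemma parent_exists (x : G) : x <> r ->
  exists y, adj y x /\ dist r x = (dist r y).+1.
Proof.
move=> xr; have [p [rp up px dx]] := simple_path_exists x.
case/lastP: p rp up px dx => [|p a] rp up; first by move=> /esym.
rewrite last_rcons => ax dx; rewrite {a}ax in rp up dx.
move: rp up; rewrite rcons_path -rcons_cons rcons_uniq => /andP[rp px] /andP[_ up].
by exists (last r p); rewrite dist_simple_path // -dx size_rcons.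
Qed.
End Levels.
End Acyclic.

(** * The binary tree of bit strings *)

(** Bits are put in front, so that the parent of a vertex is its [behead] and its
    ancestors are its suffixes. *)
Definition child_of (s t : seq bool) : bool := (t != [::]) && (s == behead t).

Definition bintree_adj h : rel {bseq h of bool} :=
  fun x y => child_of x y || child_of y x.

Lemma bintree_adj_sym h : symmetric (@bintree_adj h).
Proof. by move=> x y; rewrite /bintree_adj orbC. Qed.

Lemma child_of_size s t : child_of s t -> size t = (size s).+1.
Proof. by case: t => //= b t /eqP->. Qed.

Lemma bintree_adj_irrefl h : irreflexive (@bintree_adj h).
Proof.
move=> x; rewrite /bintree_adj orbb; apply/negP => /child_of_size /eqP.
by rewrite -addn1 -[X in X == _]addn0 eqn_add2l.
Qed.

Definition bintree h : sgraph :=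
  SGraph (@bintree_adj_sym h) (@bintree_adj_irrefl h).

Section Bintree.
Variable h : nat.
Implicit Types (x y z : bintree h) (s t u v : seq bool).

Definition addr x : seq bool := (x : {bseq h of bool}).
Definition node s : bintree h := insub_bseq h s.

Lemma size_addr x : size (addr x) <= h.
Proof. exact: size_bseq. Qed.

Lemma addr_inj : injective addr.
Proof. by move=> x y /val_inj. Qed.

Lemma nodeK s : size s <= h -> addr (node s) = s.
Proof. by move=> sh; rewrite /addr /node /insub_bseq insubdK. Qed.

Lemma addrK x : node (addr x) = x.
Proof. by apply: addr_inj; rewrite nodeK ?size_addr. Qed.

Lemma bintreeP x : exists2 s, size s <= h & x = node s.
Proof. by exists (addr x); rewrite ?addrK ?size_addr. Qed.

Lemma adjE x y :
  adj x y = child_of (addr x) (addr y) || child_of (addr y) (addr x).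
Proof. by []. Qed.

Lemma node_eq s t : size s <= h -> size t <= h -> (node s == node t) = (s == t).
Proof.
move=> sh th; apply/eqP/eqP => [|->//].
by move/(congr1 addr); rewrite !nodeK.
Qed.

Lemma adj_node_cons b s : size s < h -> adj (node s) (node (b :: s)).
Proof. by move=> sh; rewrite adjE !nodeK ?(ltnW sh) //= /child_of /= eqxx. Qed.

Lemma bintree_ind (P : bintree h -> Prop) :
  P (node [::]) ->
  (forall b s, size s < h -> P (node s) -> P (node (b :: s))) ->
  forall x, P x.
Proof.
move=> P0 PS x; have [s sh ->] := bintreeP x.
by elim: s sh => [|b s IHs] sh //; apply: PS (IHs (ltnW sh)).
Qed.

Lemma neighbors_node s : size s <= h ->
  [set y | adj (node s) y]%SET =
  ((if size s < h then [set node (false :: s); node (true :: s)] else finset.set0)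
   :|: (if s is _ :: t then [set node t] else finset.set0))%SET.
Proof.
move=> sh; apply/setP => y; have [t th ->] := bintreeP y.
rewrite !inE adjE !nodeK //; congr orb.
- case: ifPn => [ltsh|]; rewrite /child_of !inE.
    rewrite !node_eq //; case: t th => [|[] t] //= _; rewrite !eqseq_cons /= ?orbF eq_sym //.
  rewrite -leqNgt => hs; apply/negbTE/negP => /andP[t0 /eqP st].
  by case: t th t0 st => //= b t th _ st; rewrite st leqNgt th in hs.
- case: s sh => [|b s] sh; rewrite /child_of ?inE //= node_eq // ltnW //.
Qed.

Lemma card_neighbors s : size s <= h ->
  deg (node s) = 2 * (size s < h) + (s != [::]).
Proof.
move=> sh; rewrite /deg neighbors_node // cardsU; case: ifPn => [ltsh|_].
  rewrite cards2 node_eq // eqseq_cons /=.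
  case: s sh ltsh => [|b s] sh ltsh; first by rewrite finset.setI0 !cards0.
  rewrite cards1 (_ : _ :&: _ = finset.set0)%SET ?cards0 //; apply/setP => y.
  rewrite !inE; apply/negP => /andP[] /orP[] /eqP-> ; rewrite node_eq ?(ltnW sh) //.
    by move/eqP/(congr1 size)/eqP; rewrite /= -addn2 -[X in _ == X]addn0 eqn_add2l.
  by move/eqP/(congr1 size)/eqP; rewrite /= -addn2 -[X in _ == X]addn0 eqn_add2l.
by rewrite finset.set0I cards0; case: s {sh} => [|b s]; rewrite ?cards0 ?cards1.
Qed.

Lemma bintree_connected x y : connect (@adj (bintree h)) x y.
Proof.
have root z : connect (@adj (bintree h)) (node [::]) z.
  move: z; apply: bintree_ind => // b s sh IHs; apply: connect_trans IHs (connect1 _).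
  exact: adj_node_cons.
apply: connect_trans (root y); rewrite sym_connect_sym //; exact: adj_sym.
Qed.

(** A deepest vertex of a cycle would have its parent on both sides. *)
Lemma bintree_acyclic (c : seq (bintree h)) :
  2 < size c -> ~ ucycle (@adj (bintree h)) c.
Proof.
move=> c2 uc.
have [x xc xmax] : exists2 x, x \in c & forall y, y \in c -> size (addr y) <= size (addr x).
  have [x0 x0c] : exists x, x \in c by case: (c) c2 => // x s _; exists x; apply: mem_head.
  by case: (arg_maxnP (fun y => size (addr y)) x0c) => x xc xmax; exists x.
have parent y : y \in c -> adj x y -> addr y = behead (addr x).
  rewrite adjE => yc /orP[/child_of_size yx|/andP[_ /eqP//]].
  by have := xmax y yc; rewrite yx ltnn.
have [i s cs] := rot_to xc.
have uc' : ucycle (@adj (bintree h)) (x :: s) by rewrite -cs rot_ucycle.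
have s2 : 2 < size (x :: s) by rewrite -cs size_rot.
have sub y : y \in s -> y \in c by move=> ys; rewrite -(mem_rot i) cs inE ys orbT.
case: s s2 uc' sub {cs} => // y s; case/lastP: s => // s z _.
rewrite /ucycle /= rcons_path last_rcons => /andP[/and3P[xy _ zx]].
case/and3P=> _ + _; rewrite mem_rcons inE negb_or => /andP[yz _] sub.
case/eqP: yz; apply: addr_inj; rewrite (parent y) ?(parent z) ?sub //.
- by rewrite inE mem_rcons mem_head orbT.
- by rewrite adj_sym.
- exact: mem_head.
Qed.

Lemma dist_bintree x : dist (node [::]) x = size (addr x).
Proof.
apply: least_eq => [|_ [p [rp <- <-]]].
  move: x; apply: bintree_ind => [|b s sh [p [rp ps sp]]].
    by exists [::]; rewrite nodeK.
  exists (rcons p (node (b :: s))); rewrite last_rcons size_rcons sp rcons_path rp ps.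
  by rewrite adj_node_cons // !nodeK // ltnW.
have -> : size p = size (addr (node [::])) + size p by rewrite nodeK.
elim: p (node [::]) rp => [|y p IHp] z /=.
  by rewrite addn0.
case/andP=> zy /IHp{IHp}/leq_trans; apply; rewrite -addSnnS leq_add2r.
have := zy : @adj (bintree h) z y; rewrite adjE => /orP[/child_of_size->//|/child_of_size ->].
by rewrite ltnW // ltnS leqnSn.
Qed.

End Bintree.

Lemma bintree_BT h : 0 < h -> BT (bintree h).
Proof.
move=> h0; exists (node h [::]); split.
  split.
  - split; [|exact: bintree_connected|exact: bintree_acyclic].
    by apply/card_gt0P; exists (node h [::]).
  - by rewrite card_neighbors // h0.
  - move=> x; have [s sh ->] := bintreeP x; rewrite /leaf card_neighbors //.
    case: s sh => // b s sh _; case: ltnP => //.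
exists h => x; have [s sh ->] := bintreeP x; rewrite dist_bintree nodeK //.
rewrite /leaf card_neighbors //; case: ltnP => [_|hs _].
  by case: (s != [::]).
by apply/eqP; rewrite eqn_leq sh.
Qed.

Lemma card_bintree h : #|bintree h| = (2 ^ h.+1).-1.
Proof.
transitivity (\sum_(i < h.+1) 2 ^ i).
  rewrite (bij_eq_card (Bijective (@bseq_tagged_tupleK h bool) tagged_tuple_bseqK)).
  rewrite card_tagged sumnE big_map big_enum /=.
  by apply: eq_bigr => i _; rewrite card_tuple card_bool.
by rewrite predn_exp mul1n.
Qed.

(** * Every complete binary tree is a tree of bit strings *)

Section Coordinates.
Variables (G : sgraph) (r : G) (d : nat).
Hypothesis treeG : is_tree G.
Hypothesis deg_r : deg r = 2.
Hypothesis deg3 : forall x : G, x <> r -> ~~ leaf x -> deg x = 3.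
Hypothesis leaf_dist : forall x : G, leaf x -> dist r x = d.

Let acyclic (c : seq G) : 2 < size c -> ~ ucycle (@adj G) c.
Proof. by have [_ _] := treeG; apply. Qed.

Let conn (x : G) : connect (@adj G) r x.
Proof. by have [_ + _] := treeG; apply. Qed.

Definition children (x : G) : {set G} :=
  [set y | adj x y && (dist r y == (dist r x).+1)]%SET.

Lemma childrenP (x y : G) :
  reflect (adj x y /\ dist r y = (dist r x).+1) (y \in children x).
Proof. by rewrite inE; apply: (iffP andP) => -[xy /eqP]. Qed.

(** The neighbours of x are its children and, unless x is the root, its parent. *)
Lemma deg_children (x : G) : deg x = #|children x| + (x != r).
Proof.
pose par z := [set y | adj z y && (dist r z == (dist r y).+1)]%SET.
have -> : (x != r) = #|par x| :> nat.
  case: eqP => [->|/(parent_exists acyclic conn)[y [yx xy]]].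
    by apply/esym/eqP; rewrite cards_eq0; apply/eqP/setP => y;
       rewrite !inE dist_root // andbF.
  suff -> : par x = [set y]%SET by rewrite cards1.
  apply/setP => z; rewrite !inE; apply/andP/eqP => [[xz /eqP dz]|->].
    by apply: (parent_unique acyclic conn _ yx dz xy); rewrite adj_sym.
  by rewrite adj_sym yx xy eqxx.
rewrite /deg -(cardsID (children x)); congr (_ + _).
  by apply: eq_card => y; rewrite !inE andbA andbb.
apply: eq_card => y; rewrite !inE; case xy: (adj x y); rewrite ?andbF //= andbT.
by have [->|->] := dist_adjS acyclic conn xy;
  rewrite eqxx ?eqn_leq ?ltnn ?ltnNge ?leqnSn ?andbF.
Qed.

(** A deepest vertex has no children, hence is a leaf; this bounds the depth of all
    vertices by d, so that the vertices of depth d have no children either. *)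
Lemma card_children_level (x : G) :
  dist r x <= d /\ #|children x| = 2 * (dist r x < d).
Proof.
have leaf_r : ~~ leaf r by rewrite /leaf deg_r.
have inner y : ~~ leaf y -> #|children y| = 2.
  have := deg_children y; case: (eqVneq y r) => [->|/eqP yr]; rewrite ?deg_r.
    by rewrite addn0 => <-.
  by move=> dy /(deg3 yr); rewrite dy addn1 => -[].
have outer y : leaf y -> #|children y| = 0.
  move=> ly; have := ly; rewrite /leaf deg_children.
  by case: (eqVneq y r) ly => [->|_ _]; [rewrite (negbTE leaf_r) | rewrite addn1 => /eqP[]].
have [y _ ymax] := @arg_maxnP _ r predT (dist r) isT.
have leaf_y : leaf y.
  apply/negPn/negP => /inner; case: (set_0Vmem (children y)) => [->|[z /childrenP[_ dz]] _].
    by rewrite cards0.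
  by have := ymax z isT; rewrite /= dz ltnn.
have dx : dist r x <= d by rewrite -(leaf_dist leaf_y); apply: ymax.
split=> //; case: ltnP => [lt_xd|dle].
  by apply: inner; apply: contraTN lt_xd => /leaf_dist->; rewrite ltnn.
case: (boolP (leaf x)) => [/outer//|/inner]; case: (set_0Vmem (children x)) => [->|].
  by rewrite cards0.
case=> z /childrenP[_ dz] _; have := ymax z isT.
by rewrite /= dz (leaf_dist leaf_y) ltnNge dle.
Qed.

(** The default value x of [nth] is reached only if x has fewer than two children,
    that is, if x is a leaf. *)
Definition child (b : bool) (x : G) : G := nth x (enum (children x)) b.

Definition coord (s : seq bool) : G := foldr child r s.

Lemma dist_coord s : size s <= d -> dist r (coord s) = size s.
Proof.
elim: s => [_|b s IHs sd]; first exact: dist_root.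
have /childrenP[_ /=] : coord (b :: s) \in children (coord s).
  rewrite -mem_enum mem_nth // -cardE; have [_ ->] := card_children_level (coord s).
  by rewrite IHs ?(ltnW sd) // sd; case: (b).
by rewrite IHs // ltnW.
Qed.

Lemma coord_cons_children b s :
  size s < d -> coord (b :: s) \in children (coord s).
Proof.
move=> sd; rewrite -mem_enum mem_nth // -cardE.
have [_ ->] := card_children_level (coord s).
by rewrite dist_coord ?(ltnW sd) // sd; case: (b).
Qed.

Lemma children_coord s y : size s < d -> y \in children (coord s) ->
  exists b, y = coord (b :: s).
Proof.
move=> sd; rewrite -mem_enum => ys; have := ys; rewrite -index_mem -cardE.
have [_ ->] := card_children_level (coord s); rewrite dist_coord ?(ltnW sd) // sd muln1.
move=> i2; exists (index y (enum (children (coord s))) == 1).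
rewrite /= /child -[LHS](nth_index (coord s) ys); congr nth.
by case: index i2 => [|[]].
Qed.

Lemma coord_inj s t :
  size s <= d -> size t <= d -> coord s = coord t -> s = t.
Proof.
move=> sd td st; have := congr1 (dist r) st; rewrite !dist_coord //.
elim: s t sd td st => [|b s IHs] [|c t] //= sd td st [size_st].
have /childrenP[sb db] := coord_cons_children b sd.
have /childrenP[tc dc] := coord_cons_children c td.
have eq_st : s = t.
  apply: IHs (ltnW sd) (ltnW td) _ size_st.
  rewrite /= st in sb db.
  exact: (parent_unique acyclic conn sb tc db dc).
rewrite -eq_st; congr cons; move/eqP: st; rewrite -eq_st /child nth_uniq ?enum_uniq //.
- by case: (b); case: (c).
- have [_] := card_children_level (coord s); rewrite -cardE dist_coord ?(ltnW sd) // sd => ->.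
  by case: (b).
- have [_] := card_children_level (coord s); rewrite -cardE dist_coord ?(ltnW sd) // sd => ->.
  by case: (c).
Qed.

Lemma coord_surj (x : G) : exists2 s, size s <= d & x = coord s.
Proof.
have [n] := ubnP (dist r x); elim: n x => // n IHn x; rewrite ltnS => dx.
case: (eqVneq x r) => [->|/eqP xr]; first by exists [::].
have [y [yx xy]] := parent_exists acyclic conn xr.
have [s sd ys] := IHn y (leq_trans (eq_leq (esym xy)) dx).
have sltd : size s < d.
  by rewrite -(dist_coord sd) -ys -xy; have [] := card_children_level x.
have [||b ->] := @children_coord s x => //; last by exists (b :: s).
by apply/childrenP; rewrite -ys.
Qed.

Lemma adj_coord s t : size s <= d -> size t <= d ->
  adj (coord s) (coord t) = child_of s t || child_of t s.
Proof.
have half u v : size u <= d -> size v <= d -> adj (coord u) (coord v) ->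
    dist r (coord v) = (dist r (coord u)).+1 -> child_of u v.
  move=> ud vd uv; rewrite !dist_coord //.
  case: v vd uv => // b v vd uv [size_vu]; rewrite /child_of /=.
  have /childrenP[vb db] := coord_cons_children b vd.
  apply/eqP/coord_inj; rewrite ?size_vu //.
  apply: (parent_unique acyclic conn uv vb _ db).
  by rewrite db !dist_coord ?size_vu // ltnW.
have back u v : size v <= d -> child_of u v -> adj (coord u) (coord v).
  case: v => // b v vd /andP[_ /eqP->].
  by have /childrenP[] := coord_cons_children b vd.
move=> sd td; apply/idP/orP => [st|[st|ts]].
- have [dst|dst] := dist_adjS acyclic conn st; [left|right]; apply: half => //.
  by rewrite adj_sym.
- exact: back.
- by rewrite adj_sym; apply: back.
Qed.
End Coordinates.

Lemma BT_iso (G : sgraph) : BT G ->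
  exists d, 0 < d /\ exists f : bintree d -> G, graph_iso f.
Proof.
case=> r [[treeG deg_r deg3] [d leaf_dist]]; exists d; split.
  rewrite lt0n; apply/eqP => d0.
  have := @deg_children G r treeG r.
  have [_ ->] := card_children_level treeG deg_r deg3 leaf_dist r.
  by rewrite d0 deg_r eqxx.
exists (fun x => coord r (addr x)); split; last first.
  by move=> x y; rewrite (adj_coord treeG deg_r deg3 leaf_dist) ?size_addr.
have inj : injective (fun x : bintree d => coord r (addr x)).
  move=> x y /(coord_inj treeG deg_r deg3 leaf_dist) xy.
  by apply: addr_inj; apply: xy; apply: size_addr.
have surj y : exists x : bintree d, y = coord r (addr x).
  have [s sd ->] := coord_surj treeG deg_r deg3 leaf_dist y.
  by exists (node d s); rewrite nodeK.
have [g gP] := choice surj.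
exists g => [x|y]; last by rewrite -gP.
by apply: inj; rewrite -gP.
Qed.

(** * Ends of paths *)

Section PathDegree.
Variable G : sgraph.
Implicit Types (P : subgraph G) (x v : G).

Definition path_deg P v : nat := #|[set e in P.2 | v \in e]%SET|.

Definition ends P : {set G} := [set v | path_deg P v == 1]%SET.

(** A vertex of a path has one edge to its predecessor, if it has one, and one edge
    to its successor, if it has one. *)
Lemma path_deg_seq x p v : uniq (x :: p) ->
  path_deg (path_subgraph (x :: p)) v = (v \in p) + (v \in belast x p).
Proof.
elim: p x => [|y p IHp] x.
  move=> _; apply/eqP; rewrite cards_eq0; apply/eqP/setP => e; rewrite !inE.
  by have := contains_edge_sing x e; rewrite /contains_edge => ->.
move=> /[dup] uxy /andP[xyp uyp].
pose e0 : {set G} := [set x; y]%SET.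
have e0P : contains_edge (path_subgraph (y :: p)) e0 = false.
  by apply: contraNF xyp => /contains_edge_mem; apply; rewrite !inE eqxx.
transitivity ((v \in e0) + path_deg (path_subgraph (y :: p)) v).
  rewrite /path_deg (cardsD1 e0); congr (_ + _).
    congr nat_of_bool.
    have := contains_edge_cons x y p e0; rewrite /contains_edge eqxx /= => e0xy.
    by rewrite !inE e0xy.
  apply: eq_card => e; rewrite !inE.
  have := contains_edge_cons x y p e; rewrite /contains_edge => ->.
  case: eqP => [->|] //=.
  by move: e0P; rewrite /contains_edge => ->.
rewrite IHp // !inE /=; move: uyp xyp => /= /andP[yp _]; rewrite inE negb_or => /andP[xy xp].
have xb : x \notin belast y p.
  by apply: contra xp => /mem_belast; rewrite inE (negbTE xy).
case: (eqVneq v x) => [->|vx] /=; first by rewrite (negbTE xy) (negbTE xp) (negbTE xb).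
by case: (eqVneq v y) => [->|vy] //=; rewrite (negbTE yp).
Qed.

Lemma path_deg_le2 P v : is_path P -> path_deg P v <= 2.
Proof.
by case=> x [p [_ up ->]]; rewrite path_deg_seq //; do 2!case: (v \in _).
Qed.

Lemma card_ends P : is_path P -> #|ends P| <= 2.
Proof.
case=> x [p [_ up ->]]; apply: leq_trans (_ : #|[set x; last x p]%SET| <= 2).
  apply/subset_leq_card/fintype.subsetP => v; rewrite !inE path_deg_seq //.
  have vxp : (v == x) || (v \in p) = (v \in belast x p) || (v == last x p).
    by rewrite -in_cons lastI mem_rcons inE orbC.
  by move: vxp; case: (v == x); case: (v \in p); case: (v \in belast x p);
     case: (v == last x p).
by rewrite cards2; case: (x != _).
Qed.
End PathDegree.

(** * Edges of the binary tree *)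

Section BintreeEdges.
Variable h : nat.
Implicit Types (x : bintree h) (s t : seq bool) (P : subgraph (bintree h)).

(** Edges are named by their lower ends. The set [edge [::]] is a singleton, so it
    is not an edge of any path. *)
Definition edge s : {set bintree h} := [set node h s; node h (behead s)]%SET.

Definition on P s : bool := contains_edge P (edge s).

Lemma edge_edges s : s != [::] -> size s <= h -> edge s \in edges (bintree h).
Proof.
case: s => // b s _ sh; apply/edgesP; exists (node h (b :: s)), (node h s).
by rewrite adj_sym adj_node_cons.
Qed.

Lemma edges_edge e : e \in edges (bintree h) ->
  exists s, [/\ s != [::], size s <= h & e = edge s].
Proof.
case/edgesP=> x [y [xy ->]]; have [s sh xs] := bintreeP x.
have [t th yt] := bintreeP y; move: xy; rewrite xs yt adjE !nodeK //.
case/orP=> /andP[n0 /eqP st]; [exists t|exists s]; rewrite ?n0 /edge -?st //.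
by rewrite finset.setUC.
Qed.

Lemma mem_edge s t : size s <= h -> size t <= h ->
  (node h t \in edge s) = (t == s) || (t == behead s).
Proof.
move=> sh th; rewrite !inE !node_eq // size_behead.
exact: leq_trans (leq_pred _) sh.
Qed.

Lemma edge_inj s t : s != [::] -> t != [::] -> size s <= h -> size t <= h ->
  edge s = edge t -> s = t.
Proof.
move=> s0 t0 sh th st; have := mem_edge th sh; have := mem_edge sh th.
rewrite st mem_edge // -st mem_edge // !eqxx /=.
case/esym/orP=> [/eqP-> //|/eqP ts]; case/esym/orP=> [/eqP-> //|/eqP st'].
move: (congr1 size ts) (congr1 size st'); rewrite !size_behead.
by move: s0 t0; rewrite -!size_eq0; lia.
Qed.

Lemma edge_neq s t : s != [::] -> t != [::] -> size s <= h -> size t <= h ->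
  s <> t -> edge s <> edge t.
Proof. by move=> s0 t0 sh th st /edge_inj; apply: contra_not st; apply. Qed.

Lemma on_nil P : is_path P -> on P [::] = false.
Proof.
move=> pP; apply/negP => /(path_contains_edge_edges pP)/edges_edge[s [s0 sh es]].
have := mem_edge sh (leq0n h : size [::] <= h); rewrite -es !inE eqxx.
have := mem_edge sh sh; rewrite -es !inE node_eq // (negbTE s0) /=.
by rewrite eqxx.
Qed.

(** The root needs no separate case, because [on P [::]] is false. *)
Lemma path_deg_bintree P s : is_path P -> size s <= h ->
  path_deg P (node h s) =
  on P s + (size s < h) * (on P (false :: s) + on P (true :: s)).
Proof.
move=> pP sh.
pose E t := if on P t then [set edge t]%SET else finset.set0.
have cardE t : #|E t| = on P t by rewrite /E; case: ifP; rewrite ?cards1 ?cards0.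
have EP t e : e \in E t -> on P t /\ e = edge t.
  by rewrite /E; case: ifP; rewrite !inE // => _ /eqP.
have disj t u : t != u -> size t <= h -> size u <= h -> [disjoint E t & E u].
  move=> tu th uh; apply/pred0P => e; apply/negP => /andP[/EP[Pt ->] /EP[Pu tu']].
  case/eqP: tu; apply: edge_inj tu' => //.
    by apply: contraTneq Pt => ->; rewrite on_nil.
  by apply: contraTneq Pu => ->; rewrite on_nil.
have inc e : (e \in [set e in P.2 | node h s \in e]%SET) =
    (e \in E s) || ((size s < h) && ((e \in E (false :: s)) || (e \in E (true :: s)))).
  rewrite inE; apply/andP/idP => [[eP]|].
    have [t [t0 th et]] := edges_edge (path_contains_edge_edges pP eP).
    have onE : e \in E t by rewrite /E /on /contains_edge -et eP et inE.
    rewrite et mem_edge // => /orP[/eqP ->|/eqP ->]; first by rewrite -et onE.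
    case: t t0 th et onE => //= b t _ th -> bt.
    by rewrite th /=; case: b th bt => _ ->; rewrite ?orbT.
  case/orP=> [/EP[Ps ->]|/andP[lt_sh /orP[] /EP[Ps ->]]]; split=> //;
    by rewrite mem_edge //= eqxx ?orbT.
have cardU (A B : {set {set bintree h}}) :
    [disjoint A & B] -> #|(A :|: B)%SET| = #|A| + #|B|.
  by move=> AB; rewrite cardsU disjoint_setI0 // cards0 subn0.
rewrite /path_deg (_ : [set e in P.2 | node h s \in e]%SET = E s :|:
   (if size s < h then E (false :: s) :|: E (true :: s) else finset.set0))%SET; last first.
  by apply/setP => e; rewrite inc; case: ifP; rewrite !inE.
case: ltnP => lt_sh /=; last by rewrite finset.setU0 cardE mul0n addn0.
have ns b : s != b :: s.
  by apply/eqP => /(congr1 size) /=; lia.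
have disj01 : [disjoint E (false :: s) & E (true :: s)].
  by rewrite disj // eqseq_cons.
rewrite !cardU ?mul1n ?cardE // disjoint_sym -finset.setI_eq0 finset.setIUl.
by rewrite !disjoint_setI0 ?finset.setU0 // disjoint_sym disj.
Qed.

End BintreeEdges.

(** * Lower bounds *)

Lemma other_edge h (s : seq bool) : 0 < h -> exists t,
  [/\ t != [::], size t <= h & s <> t].
Proof.
move=> h0; case: (eqVneq s [:: true]) => [->|/eqP st]; first by exists [:: false].
by exists [:: true].
Qed.

Section StrongLowerBound.
Variables (h : nat) (S : {set subgraph (bintree h)}).
Hypothesis h0 : 0 < h.
Hypothesis sepS : is_strong_sep S.

Let isp P : P \in S -> is_path P. Proof. by case: sepS => + _; apply. Qed.

Let leaf_nonnil (s : seq bool) : size s = h -> s != [::].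
Proof. by case: s => // h00; move: h0; rewrite -h00. Qed.

Lemma strong_sep_edge (s t : seq bool) : s != [::] -> t != [::] -> size s <= h -> size t <= h ->
  s <> t -> exists P, [/\ P \in S, on P s & ~~ on P t].
Proof.
move=> s0 t0 sh th st; have [_ sep] := sepS.
by apply: sep; rewrite ?edge_edges //; apply: edge_neq.
Qed.

(** A leaf edge lies on two paths, or else on a single path that contains nothing
    else. Giving the edges of the second kind weight 2 and the others weight 1,
    each leaf edge collects at least 2 from the paths through it, and each path
    pays at most 2, as the leaves that it reaches are among its ends. *)
Lemma strong_sep_card : 2 ^ h <= #|S|.
Proof.
pose m (l : h.-tuple bool) := #|[set P in S | on P l]%SET|.
pose f l := if m l == 1 then 2 else 1.
have pay P : P \in S -> \sum_(l | on P (val l)) f l <= 2.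
  move=> PS; case: (pickP (fun l : h.-tuple bool => on P l && (m l == 1))).
    (* The only path P through l contains no other leaf edge l', since some path
       contains l and avoids l'. *)
    move=> l /andP[Pl ml]; rewrite (big_pred1 l) /f ?ml // => l'.
    rewrite /=; apply/idP/eqP => [Pl'|->//]; apply/val_inj/eqP/negPn/negP => /eqP ll'.
    have lh (a : h.-tuple bool) : size a <= h by rewrite size_tuple.
    have a0 (a : h.-tuple bool) : tval a != [::] by rewrite leaf_nonnil // size_tuple.
    have [Q [QS Ql Ql']] : exists Q, [/\ Q \in S, on Q l & ~~ on Q l'].
      by apply: strong_sep_edge => // /esym.
    have /cards1P[P0 mP0] := ml.
    have QP0 : Q \in [set P0]%SET by rewrite -mP0 inE QS.
    have PP0 : P \in [set P0]%SET by rewrite -mP0 inE PS.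
    have QP : Q = P by rewrite (set1P QP0) (set1P PP0).
    by rewrite QP Pl' in Ql'.
  move=> none; apply: leq_trans (card_ends (isp PS)).
  rewrite (eq_bigr (fun=> 1)); last first.
    by move=> l Pl; have := none l; rewrite /f Pl /= => ->.
  rewrite sum1_card -(card_imset _ (f := fun l : h.-tuple bool => node h l)); last first.
    move=> a b /eqP; rewrite node_eq ?size_tuple // => /eqP; exact: val_inj.
  apply/subset_leq_card/fintype.subsetP => _ /imsetP[l Pl ->].
  rewrite inE (path_deg_bintree (isp PS)) ?size_tuple // ltnn mul0n addn0.
  by have -> : on P l by exact: Pl.
have collect l : 2 <= m l * f l.
  have : 0 < m l.
    have [t [t0 th lt]] := other_edge l h0.
    have ln : tval l != [::] by rewrite leaf_nonnil // size_tuple.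
    have lh : size l <= h by rewrite size_tuple.
    have [P [PS Pl _]] := strong_sep_edge ln t0 lh th lt.
    by apply/card_gt0P; exists P; rewrite inE PS.
  by rewrite /f; case: eqP => [->//|]; case: (m l) => [|[|]].
have : \sum_l m l * f l <= #|S| * 2.
  rewrite -sum_nat_const.
  apply: leq_trans (_ : \sum_(P in S) \sum_(l : h.-tuple bool | on P l) f l <= _).
    rewrite (exchange_big_dep predT) //=; apply: leq_sum => l _.
    rewrite sum_nat_const; apply: eq_leq; congr (_ * _).
    by apply: eq_card => P; rewrite !inE.
  exact: leq_sum pay.
apply: contra_leq => lt_S; apply: leq_trans (_ : #|{: h.-tuple bool}| * 2 <= _).
  by rewrite ltn_mul2r card_tuple card_bool.
by rewrite -sum_nat_const; apply: leq_sum => l _; apply: collect.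
Qed.
End StrongLowerBound.

Section RainbowLowerBound.
Variables (h k n : nat) (P : 'I_n -> subgraph (bintree h)) (col : 'I_n -> 'I_k).
Hypothesis h0 : 0 < h.
Hypothesis isp : forall i, is_path (P i).
Hypothesis sepP : forall e1 e2 : {set bintree h},
  e1 \in edges (bintree h) -> e2 \in edges (bintree h) -> e1 <> e2 ->
  exists i j : 'I_n,
    [/\ col i <> col j,
        contains_edge (P i) e1 /\ ~~ contains_edge (P i) e2 &
        contains_edge (P j) e2 /\ ~~ contains_edge (P j) e1].
Implicit Types (s t u v w : seq bool) (x : bintree h).

Lemma rainbow_edge s t : s != [::] -> t != [::] -> size s <= h -> size t <= h ->
  s <> t -> exists i j, [/\ col i != col j, on (P i) s, ~~ on (P i) t,
                            on (P j) t & ~~ on (P j) s].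
Proof.
move=> s0 t0 sh th /(edge_neq s0 t0 sh th) st.
have [i [j [/eqP cij [] si ti [tj sj]]]] :=
  sepP (edge_edges s0 sh) (edge_edges t0 th) st.
by exists i, j.
Qed.

Definition through s : {set 'I_n} := [set i | on (P i) s]%SET.

Definition mono s : bool :=
  (s != [::]) && [forall i in through s, forall j in through s, col i == col j].

Lemma through_nonempty s : s != [::] -> size s <= h -> exists i, i \in through s.
Proof.
move=> s0 sh; have [t [t0 th st]] := other_edge s h0.
have [i [j [_ si _ _ _]]] := rainbow_edge s0 t0 sh th st.
by exists i; rewrite inE.
Qed.

(** Two edges whose paths all have the same colour cannot be separated, so the
    monochromatic edges are determined by their colours. The bound exceeds k by one
    because [color] takes values in an option type, but its value [None] on edges
    without paths never occurs. *)
Lemma card_mono : #|[set x : bintree h | mono (addr x)]%SET| <= k.+1.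
Proof.
pose color (x : bintree h) := omap col [pick i in through (addr x)].
have -> : k.+1 = #|{: option 'I_k}| by rewrite card_option card_ord.
rewrite -(card_in_imset (f := color)) ?max_card // => x y.
rewrite !inE => /andP[x0 /'forall_in_forall_inP monx] /andP[y0 /'forall_in_forall_inP mony].
move=> cxy; apply: addr_inj; apply/eqP/negPn/negP => /eqP xy.
have [i [j [cij xi _ yj _]]] := rainbow_edge x0 y0 (size_addr x) (size_addr y) xy.
move: cxy; rewrite /color; case: pickP => [a ax|/(_ i)]; last by rewrite inE xi.
case: pickP => [b yb|/(_ j)]; last by rewrite inE yj.
case=> cab; case/eqP: cij.
rewrite (eqP (monx _ _ _ ax)) ?inE // cab; apply/eqP/mony => //.
by rewrite inE.
Qed.

(** The ends of paths at s, of which there are at most two for each path. The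
    surcharge on monochromatic edges makes up for leaf edges that lie on one path
    only, so that every leaf is charged at least 2; it is large enough that a leaf
    with a monochromatic edge is charged more than that. *)
Definition charge s : nat :=
  #|[set i | node h s \in ends (P i)]%SET| + 2 * mono s.

Lemma ends_leaf s : size s = h ->
  [set i | node h s \in ends (P i)]%SET = through s.
Proof.
move=> sh; apply/setP => i; rewrite !inE (path_deg_bintree (isp i)) ?sh //.
by rewrite ltnn addn0; case: (on _ _).
Qed.

Lemma charge_leaf s : size s = h -> 2 <= charge s.
Proof.
move=> sh; have s0 : s != [::] by case: s sh => // sh; move: h0; rewrite -sh.
rewrite /charge ends_leaf //; case: (boolP (mono s)) => [_|]; first by rewrite muln1 leq_addl.
rewrite muln0 addn0 /mono s0 /= => /forall_inPn[i si /forall_inPn[j sj cij]].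
apply/card_gt1P; exists i, j; split=> //.
by apply: contraNneq cij => ->.
Qed.

(** The lower bound on [charge], 2 for leaves and 0 for other vertices, is not
    attained at s. *)
Definition defect s : bool := (2 * (size s == h) < charge s).

Lemma sum_charge : \sum_(x : bintree h) charge (addr x) <= 2 * n + 2 * k.+1.
Proof.
rewrite big_split /=; apply: leq_add.
  rewrite (eq_bigr (fun x : bintree h => \sum_(i < n) (x \in ends (P i)))); last first.
    move=> x _; rewrite addrK -sum1_card big_mkcond /=; apply: eq_bigr => i _.
    by rewrite inE; case: (x \in _).
  rewrite exchange_big /=; apply: leq_trans (_ : \sum_(i < n) 2 <= _).
    apply: leq_sum => i _; apply: leq_trans (card_ends (isp i)).
    by rewrite -sum1_card [leqRHS]big_mkcond /=; apply: leq_sum => x _; case: (x \in _).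
  by rewrite sum_nat_const card_ord mulnC.
rewrite -big_distrr /= leq_mul2l /=; apply: leq_trans card_mono.
apply: eq_leq; rewrite -sum1_card [RHS]big_mkcond /=; apply: eq_bigr => x _.
by rewrite inE; case: (mono _).
Qed.

Lemma card_leaves : #|[set x : bintree h | size (addr x) == h]%SET| = 2 ^ h.
Proof.
transitivity #|{: h.-tuple bool}|; last by rewrite card_tuple card_bool.
rewrite -(card_imset _ (f := fun l : h.-tuple bool => node h l)); last first.
  by move=> a b /eqP; rewrite node_eq ?size_tuple // => /eqP; apply: val_inj.
apply: eq_card => x; rewrite inE; apply/eqP/imsetP => [xh|[l _ ->]].
  by exists (Tuple (introT eqP xh)) => //=; rewrite addrK.
by rewrite nodeK size_tuple.
Qed.

Lemma sum_charge_ge :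
  2 * 2 ^ h + #|[set x : bintree h | defect (addr x)]%SET| <= \sum_(x : bintree h) charge (addr x).
Proof.
rewrite -card_leaves -!sum1_card big_distrr /= [X in X + _]big_mkcond.
rewrite [X in _ + X]big_mkcond -big_split /=; apply: leq_sum => x _.
rewrite !inE /defect; case: eqP => [/charge_leaf cx|_]; last by case: ltnP.
by rewrite muln1; case: ltnP => //; rewrite addn1.
Qed.

Section Block.
Variables (m : nat) (u : seq bool).
Hypotheses (size_u : size u = m) (mkh : m + k = h).

Let below s := (m < size s <= h) && (drop (size s - m) s == u).

Hypothesis nodefect : forall s, below s -> ~~ defect s.

Let below_nonnil s : below s -> s != [::].
Proof. by case/andP=> /andP[+ _] _; case: s. Qed.

Let below_cons b s : below s -> size s < h -> below (b :: s).
Proof.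
case/andP=> /andP[ms _] /eqP su sh; rewrite /below /= sh (leq_trans ms) //.
by rewrite subSn 1?ltnW //= su eqxx.
Qed.

Let below_size s : below s -> size s <= h.
Proof. by case/andP=> /andP[]. Qed.

Let below_mono s : below s -> ~~ mono s.
Proof.
move=> su; have := nodefect su; rewrite /defect -leqNgt /charge.
case: eqP => [sh|_] /=; last by case: (mono s); rewrite // muln1 addnC.
rewrite ends_leaf //; have [i] := through_nonempty (below_nonnil su) (below_size su).
case: (mono s) => // si; rewrite muln1 -[leqRHS]add0n leq_add2r leqNgt.
by move/negP; case; apply/card_gt0P; exists i.
Qed.

Let below_deg s i : below s -> size s < h -> path_deg (P i) (node h s) != 1.
Proof.
move=> su sh; have := nodefect su; rewrite /defect -leqNgt /charge.
rewrite (ltn_eqF sh) muln0 leqn0 addn_eq0 cards_eq0 => /andP[/eqP se _].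
by move/setP/(_ i): se; rewrite !inE => ->.
Qed.

(** No path ends at an inner vertex s below u, so the paths through the edge of s are
    those that contain exactly one of the two edges to the children of s. Some path
    contains both of these, since a path that separates the edge to a child from the
    edge of s must go on to the other child. This leaves at most 2 + 2 - 2 paths. *)
Let below_through s : below s -> #|through s| <= 2.
Proof.
have [j] := ubnP (h - size s); elim: j s => // j IHj s; rewrite ltnS => hj su.
have [sh|sh] := ltnP (size s) h; last first.
  have {}sh : size s = h by apply/eqP; rewrite eqn_leq sh below_size.
  have := nodefect su; rewrite /defect -leqNgt /charge ends_leaf // sh eqxx muln1.
  exact: leq_trans (leq_addr _ _).
have s0 := below_nonnil su.
have su0 := below_cons false su sh; have su1 := below_cons true su sh.
have deg i := path_deg_bintree (isp i) (ltnW sh).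
have dle i := path_deg_le2 (node h s) (isp i).
have dne i := below_deg i su sh.
have sub : through s \subset
    ((through (false :: s) :|: through (true :: s)) :\:
     (through (false :: s) :&: through (true :: s)))%SET.
  apply/fintype.subsetP => i; rewrite !inE => si.
  by have := dle i; have := dne i; rewrite deg sh si; do 2!case: (on _ _).
have [a [b [_ a0 as_ _ _]]] :
    exists i j, [/\ col i != col j, on (P i) (false :: s), ~~ on (P i) s,
                    on (P j) s & ~~ on (P j) (false :: s)].
  apply: rainbow_edge; rewrite ?below_size //.
  by move/(congr1 size) => /=; lia.
have both : 0 < #|(through (false :: s) :&: through (true :: s))%SET|.
  apply/card_gt0P; exists a; rewrite !inE a0 /=.
  by have := dne a; rewrite deg sh a0 (negbTE as_); case: (on _ _).
have le0 : #|through (false :: s)| <= 2 by apply: IHj => //=; lia.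
have le1 : #|through (true :: s)| <= 2 by apply: IHj => //=; lia.
have := subset_leq_card sub; rewrite cardsD.
rewrite (finset.setIidPr _); last first.
  by apply: fintype.subset_trans (finset.subsetIl _ _) (finset.subsetUl _ _).
have := cardsUI (through (false :: s)) (through (true :: s)).
by lia.
Qed.

(** A path through an edge just below u cannot stop before it reaches a leaf. *)
Let descent j : j < k -> exists i s,
  [/\ below s, size s = m + j.+1 & forall l, l <= j -> on (P i) (drop l s)].
Proof.
elim: j => [|j IHj] jk.
  have su : below (true :: u).
    by rewrite /below [size (true :: u)]/= size_u subSnn drop1 /= eqxx andbT; lia.
  have [i si] := through_nonempty (below_nonnil su) (below_size su).
  exists i, (true :: u); split=> //=; first by rewrite size_u addn1.
  by move=> l; rewrite leqn0 => /eqP->; move: si; rewrite inE.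
have [i [s [su ss si]]] := IHj (ltnW jk).
have sh : size s < h by rewrite ss -mkh ltn_add2l.
have [b sb] : exists b, on (P i) (b :: s).
  have := below_deg i su sh; rewrite (path_deg_bintree (isp i) (ltnW sh)) sh.
  have := si 0 isT; rewrite drop0 => ->.
  case s0: (on (P i) (false :: s)); first by exists false.
  by case s1: (on (P i) (true :: s)) => // _; exists true.
exists i, (b :: s); split; first exact: below_cons.
  by rewrite /= ss; lia.
by case=> [_|l lj]; rewrite ?drop0 //; apply: si.
Qed.

(** A path i that descends from u to a leaf s contains the k edges [drop l s], each of
    which lies on only one other path f l. Two of these edges can be separated only
    by f, so the k paths f l have different colours, none of them the colour of i. *)
Lemma block_defect_absurd : False.
Proof.
have k0 : 0 < k.
  case: (posnP k) => // k0; have [i _] := @through_nonempty [:: true] isT h0.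
  by case: (col i) => c; rewrite k0.
have [] := descent (j := k.-1); first by rewrite prednK.
move=> i [s [su ss si]]; rewrite prednK // in ss.
have {}si l : l < k -> on (P i) (drop l s) by move=> lk; apply: si; rewrite -ltnS prednK.
have below_drop l : l < k -> below (drop l s).
  move=> lk; move: su; rewrite /below size_drop ss drop_drop => /andP[_ /eqP <-].
  rewrite [X in drop X s == _](_ : _ = m + k - m); last by lia.
  by rewrite eqxx andbT; lia.
have size_drop_s l : size (drop l s) = m + k - l by rewrite size_drop ss.
have partner (l : 'I_k) : exists j, (j \in through (drop l s)) && (col j != col i).
  have := below_mono (below_drop l (ltn_ord l)); rewrite /mono below_nonnil ?below_drop //.
  case/forall_inPn=> a sa /forall_inPn[b sb ab].
  case: (eqVneq (col a) (col i)) => [cai|cai]; last by exists a; rewrite sa.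
  by exists b; rewrite sb -cai eq_sym.
have [f fP] := fin_all_exists partner.
have only (l : 'I_k) a : a \in through (drop l s) -> a != i -> a = f l.
  move=> sa ai; have /andP[sf cf] := fP l.
  apply/eqP/negPn/negP => af; have := below_through (below_drop l (ltn_ord l)).
  rewrite leqNgt => /negP; case; apply/card_gt2P; exists i, (f l), a; split; split=> //.
  - by rewrite inE si.
  - by apply: contraNneq cf => ->.
  - by rewrite eq_sym.
have cf_inj : injective (col \o f).
  move=> l l' /= cll'; apply/val_inj/eqP/negPn/negP => /eqP ll'.
  have bl := below_drop l (ltn_ord l); have bl' := below_drop l' (ltn_ord l').
  have [|a [b [cab al al' bl1 bl1']]] := rainbow_edge (below_nonnil bl)
      (below_nonnil bl') (below_size bl) (below_size bl').
    move/(congr1 size); rewrite !size_drop_s => sll'.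
    by apply: ll' => /=; have := ltn_ord l; have := ltn_ord l'; lia.
  have al0 : a = f l.
    by apply: only; [rewrite inE | apply: contraNneq al' => ->; apply: si].
  have bl0 : b = f l'.
    by apply: only; [rewrite inE | apply: contraNneq bl1' => ->; apply: si].
  by rewrite al0 bl0 cll' eqxx in cab.
have := subset_leq_card (_ : (col \o f) @: [set: 'I_k] \subset [set~ col i])%SET.
rewrite card_imset // cardsT cardsC1 card_ord => absurd.
suff : k <= k.-1 by rewrite leqNgt prednK // leqnn.
apply: absurd; apply/fintype.subsetP => _ /imsetP[l _ ->].
by rewrite !inE; case/andP: (fP l).
Qed.
End Block.

(** The subtrees below different vertices of depth h - k are disjoint, and each of
    them has a defect. *)
Lemma card_defect : k <= h -> 2 ^ (h - k) <= #|[set x : bintree h | defect (addr x)]%SET|.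
Proof.
move=> kh; pose m := h - k; have mkh : m + k = h by rewrite subnK.
have ex (u : m.-tuple bool) : exists x : bintree h,
    [&& m < size (addr x), drop (size (addr x) - m) (addr x) == u & defect (addr x)].
  apply: contrapT => none; apply: (@block_defect_absurd m u (size_tuple u) mkh).
  move=> s /andP[/andP[ms sh] su]; apply/negP => ds; apply: none.
  by exists (node h s); rewrite nodeK // ms su.
have [f fP] := fin_all_exists ex.
have -> : 2 ^ m = #|(f @: [set: m.-tuple bool])%SET|.
  rewrite card_imset ?cardsT ?card_tuple ?card_bool // => u v fuv; apply: val_inj.
  have /and3P[_ /eqP uf _] := fP u; have /and3P[_ /eqP vf _] := fP v.
  by rewrite /= -uf -vf fuv.
apply/subset_leq_card/fintype.subsetP => _ /imsetP[u _ ->].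
by rewrite inE; case/and3P: (fP u).
Qed.

Lemma rainbow_card : k <= h -> 2 * 2 ^ h + 2 ^ (h - k) <= 2 * n + 2 * k.+1.
Proof.
move=> kh; apply: leq_trans sum_charge; apply: leq_trans sum_charge_ge.
by rewrite leq_add2l card_defect.
Qed.
End RainbowLowerBound.

(** * Zigzag paths *)

Section Zigzag.
Variable h : nat.
Implicit Types (s t u v w : seq bool) (l : seq (seq bool)).

Lemma is_path_sorted (G : sgraph) (x : G) q :
  sorted (@adj G) q -> uniq q -> q != [::] -> is_path (path_subgraph q).
Proof. by case: q => // y p yp uq _; exists y, p. Qed.

Lemma path_child_adj v l : path child_of v l -> all (fun s => size s <= h) l ->
  path (@adj (bintree h)) (node h v) (map (node h) l).
Proof.
elim: l v => //= s l IHl v /andP[vs sl] /andP[sh lh].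
rewrite IHl // andbT; case: s vs sh {sl lh} => // b s /andP[_ /eqP->] sh.
exact: adj_node_cons.
Qed.

Lemma path_child_uniq v l : path child_of v l -> uniq (v :: l).
Proof.
move=> vl; apply: (@sorted_uniq _ (fun s t => size s < size t)).
- by move=> t s u; apply: ltn_trans.
- by move=> s; rewrite ltnn.
- by apply: sub_path vl => s t /child_of_size->.
Qed.

Lemma contains_edge_chain v l e : path child_of v l ->
  contains_edge (path_subgraph (map (node h) (v :: l))) e =
  has (fun s => e == edge h s) l.
Proof.
elim: l v => [|s l IHl] v /=; first by rewrite contains_edge_sing.
case/andP=> /andP[_ /eqP vs] sl; rewrite contains_edge_cons -(IHl s sl).
by rewrite finset.setUC vs.
Qed.

(** The zigzag path at v turns at v and follows two legs, which bend once and then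
    run straight to a leaf. An edge whose lower end is s = c ... c b v, with a run of
    one or more bits c different from b, then lies on two of these paths: the one
    that turns at its upper end, where s starts a leg, and the one that turns at v. *)
Definition leg b v := traject (cons (~~ b)) (b :: v) (h - size v).

Lemma legP b v s : reflect
  (exists2 j, j < h - size v & s = nseq j (~~ b) ++ b :: v) (s \in leg b v).
Proof.
have iterE j t : iter j (cons (~~ b)) t = nseq j (~~ b) ++ t.
  by elim: j => //= j ->.
by apply: (iffP trajectP) => -[j jh ->]; exists j; rewrite ?iterE.
Qed.

Lemma path_leg b v : path child_of v (leg b v).
Proof.
rewrite /leg; move: (h - size v) => n; elim: n {2}b v => //= n IHn c v.
by rewrite /child_of eqxx /=; apply: IHn.
Qed.

Lemma leg_size b v : all (fun s => size s <= h) (leg b v).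
Proof.
apply/allP => _ /legP[j jh ->]; rewrite size_cat size_nseq /=; lia.
Qed.

Definition zigzag v : subgraph (bintree h) :=
  path_subgraph (map (node h) (rev (leg false v) ++ v :: leg true v)).

Lemma leg_suffix b v s : s \in leg b v -> drop (size s - (size v).+1) s = b :: v.
Proof.
by case/legP=> j _ ->; rewrite size_cat /= size_nseq addnK drop_size_cat ?size_nseq.
Qed.

Lemma is_path_zigzag v : size v <= h -> is_path (zigzag v).
Proof.
move=> vh; apply: (is_path_sorted (node h v)).
- rewrite map_cat map_rev /= sorted_cat_cons -rev_cons rev_sorted /=.
  rewrite (eq_path (e' := @adj (bintree h))) ?path_child_adj ?path_leg ?leg_size //.
  by move=> x y; rewrite adj_sym.
- rewrite map_inj_in_uniq.
    rewrite -cat_rcons cat_uniq -rev_cons rev_uniq.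
    have /andP[vl ul] : (v \notin leg true v) && uniq (leg true v).
      exact: path_child_uniq (path_leg true v).
    rewrite path_child_uniq ?path_leg // ul andbT; apply/hasPn => s sl.
    rewrite mem_rev inE; apply/norP; split; first by apply: contraNneq vl => sv; rewrite -{1}sv.
    by apply/negP => /leg_suffix; rewrite (leg_suffix sl).
  move=> s t; rewrite !mem_cat !mem_rev !inE.
  have sz b w : w \in leg b v -> size w <= h by move/(allP (leg_size b v)).
  have sz' w : [|| w \in leg false v, w == v | w \in leg true v] -> size w <= h.
    by case/or3P=> [/sz|/eqP->|/sz].
  by move=> /sz' sh /sz' th /eqP; rewrite node_eq // => /eqP.
- by rewrite -size_eq0 size_map size_cat /= addnS.
Qed.

Lemma on_zigzag v s : s != [::] -> size s <= h ->
  on (zigzag v) s = (s \in leg false v) || (s \in leg true v).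
Proof.
move=> s0 sh; rewrite /on /zigzag map_cat map_rev /= contains_edge_cat -rev_cons.
rewrite contains_edge_rev -!map_cons !contains_edge_chain ?path_leg //.
have hasE b : has (fun t => edge h s == edge h t) (leg b v) = (s \in leg b v).
  apply/hasP/idP => [[t tl /eqP/edge_inj->//]|sl]; last by exists s.
    by apply: contraTneq tl => ->; apply/negP => /leg_suffix.
  exact: (allP (leg_size b v)).
by rewrite !hasE.
Qed.

Lemma on_zigzagP v s : s != [::] -> size s <= h -> size v < h ->
  reflect (exists j b, s = nseq j (~~ b) ++ b :: v) (on (zigzag v) s).
Proof.
move=> s0 sh vh; rewrite on_zigzag //.
apply: (iffP orP) => [[]/legP[j _ ->]|[j [b sE]]].
- by exists j, false.
- by exists j, true.
- suff : s \in leg b v by case: (b); auto.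
  apply/legP; exists j => //; move: sh; rewrite sE size_cat size_nseq /=; lia.
Qed.

(** On the path at v, the edge t is a run of [~~ b] in front of [b :: v]; on the path at
    w it is a run of [~~ c] in front of [c :: w]. As w itself is a run of [~~ b] in front
    of [b :: v], comparing both forms gives [c = ~~ b], and the run of [~~ c] is empty. *)
Lemma zigzag_meet j b v w t : w = nseq j (~~ b) ++ b :: v -> size w < h ->
  t != [::] -> size t <= h -> on (zigzag w) t -> on (zigzag v) t ->
  t = ~~ b :: w.
Proof.
move=> wE wh t0 th.
have sz : size w = j + (size v).+1 by rewrite wE size_cat size_nseq.
case/on_zigzagP=> // i [c tw]; case/on_zigzagP=> //; first by lia.
move=> i' [b' tv].
have := congr1 size tv; rewrite {1}tw !size_cat !size_nseq /= sz => szE.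
(* t is longer than w, so its suffix of length |v| + 1 can be read off from w. *)
have eqb : b' = b.
  have := congr1 (drop i') tv; rewrite drop_size_cat ?size_nseq // tw.
  rewrite drop_cat size_nseq ifN; last by lia.
  rewrite (_ : i' - i = j.+1) /=; last by lia.
  by rewrite wE drop_size_cat ?size_nseq // => -[].
rewrite {}eqb in tv.
have pre n : n < i' -> nth b t n = ~~ b.
  by move=> ni; rewrite tv nth_cat size_nseq ni nth_nseq ni.
have cE : c = ~~ b.
  rewrite -(pre i); last by lia.
  by rewrite tw nth_cat size_nseq ltnn subnn.
case: i tw szE => [|i] tw szE; first by rewrite tw cE.
have := pre 0; rewrite tw /= cE; case: (b) => //=; move=> /(_ ltac:(lia)) //.
Qed.
End Zigzag.

(** * Upper bounds *)

Lemma sep_number_rsps (G : sgraph) k : 2 <= k ->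
  exists P : 'I_(sep_number (Some k) G) -> subgraph G, is_rsps k P.
Proof. by move=> k2; have [] := leastP (rsps_exists G k2). Qed.

Lemma sep_number_strong (G : sgraph) :
  exists S : {set subgraph G}, is_strong_sep S /\ #|S| = sep_number None G.
Proof. by have [] := leastP (strong_sep_exists G). Qed.

Lemma sep_number_None_le (G : sgraph) (S : {set subgraph G}) :
  is_strong_sep S -> sep_number None G <= #|S|.
Proof.
by move=> sS; have [_] := leastP (strong_sep_exists G); apply; exists S.
Qed.

(** Forgetting colours and multiplicities turns a rainbow system into a strong one. *)
Lemma sep_number_None_Some (G : sgraph) k : 2 <= k ->
  sep_number None G <= sep_number (Some k) G.
Proof.
move=> k2; have [P [isp [col sepP]]] := sep_number_rsps G k2.
apply: leq_trans (_ : #|[set P i | i in 'I_(sep_number (Some k) G)]%SET| <= _).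
  apply: sep_number_None_le; split=> [_ /imsetP[i _ ->]//|e f eG fG ef].
  have [i [_ [_ [ei fi] _]]] := sepP e f eG fG ef.
  by exists (P i); split=> //; apply: imset_f.
by apply: leq_trans (leq_imset_card _ _) _; rewrite card_ord.
Qed.

Lemma sep_number_Some_le (G : sgraph) (I C : finType)
    (P : I -> subgraph G) (col : I -> C) :
  1 < #|C| -> (forall i, is_path (P i)) ->
  (forall e f, e \in edges G -> f \in edges G -> e <> f -> exists i j,
     [/\ col i <> col j, contains_edge (P i) e /\ ~~ contains_edge (P i) f &
         contains_edge (P j) f /\ ~~ contains_edge (P j) e]) ->
  sep_number (Some #|C|) G <= #|I|.
Proof.
move=> C2 isp sep; have [_] := leastP (rsps_exists G C2); apply.
exists (P \o enum_val); split=> [i|]; first exact: isp.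
exists (enum_rank \o col \o enum_val) => e f eG fG ef.
have [i [j [cij ei fj]]] := sep e f eG fG ef.
exists (enum_rank i), (enum_rank j); rewrite /= !enum_rankK; split=> //.
by move/enum_rank_inj.
Qed.

Lemma run_split (y : seq bool) :
  (exists c, y = nseq (size y) c) \/
  (exists j b v, y = nseq j.+1 (~~ b) ++ b :: v).
Proof.
elim: y => [|c y [[c' yE]|[j [b [v yE]]]]]; first by left; exists true.
  case: y yE => [_|a y /= [-> yE]]; first by left; exists c.
  case: (eqVneq c c') => [->|cc']; first by left; exists c'; rewrite /= -yE.
  right; exists 0, c', y => /=.
  by case: (c) (c') cc' => [] [].
right; case: (eqVneq c (~~ b)) => [->|cb]; first by exists j.+1, b, v; rewrite yE.
by exists 0, (~~ b), (nseq j (~~ b) ++ b :: v); rewrite yE /=; case: (c) (b) cb => [] [].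
Qed.

Section UpperBound.
Variables (h' D : nat).
Let h := h'.+1.
Hypothesis Dh : D <= h.
Let m := h - D.
Implicit Types (s t u v w : seq bool).

(** A block is named by its root, the ancestor at depth m of its vertices. *)
Let block s := drop (size s - m) s.

Let single s : subgraph (bintree h) :=
  if s is [::] then path_subgraph [:: node h [::]]
  else path_subgraph [:: node h s; node h (behead s)].

Let is_path_single s : size s <= h -> is_path (single s).
Proof.
case: s => [|b s] sh; first by exists (node h [::]), [::].
have ss : node h (b :: s) != node h s.
  by rewrite node_eq ?(ltnW sh) //; apply/eqP => /(congr1 size) /=; lia.
exists (node h (b :: s)), [:: node h s]; split=> //=.
  by rewrite andbT -[bintree_adj _ _]/(adj (node h (b :: s)) (node h s)) adj_sym adj_node_cons.
by rewrite inE ss.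
Qed.

Let on_single s t : s != [::] -> t != [::] -> size s <= h -> size t <= h ->
  on (single s) t = (t == s).
Proof.
case: s => // b s _ t0 sh th; rewrite /on /single contains_edge_cons.
rewrite contains_edge_sing orbF -[[set _; _]%SET]/(edge h (b :: s)).
by apply/eqP/eqP => [/edge_inj->|->].
Qed.

(** A zigzag path for each inner vertex, and two copies of a single-edge path for each
    edge that [single_addr] lists. *)
Let index : finType := ({bseq h' of bool} +
  ({bseq m of bool} * 'I_D.+1 * bool) * bool)%type.

Let single_addr (x : {bseq m of bool} * 'I_D.+1 * bool) : seq bool :=
  nseq x.1.2 x.2 ++ x.1.1.

Let family (i : index) : subgraph (bintree h) :=
  match i with inl v => zigzag h v | inr x => single (single_addr x.1) end.

(** A zigzag path in a block is coloured by the position of its turning point in the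
    block. *)
Let color (i : index) : (bool + {bseq D of bool})%type :=
  match i with
  | inl v => inr (insub_bseq D (take (size v - m) v))
  | inr x => inl x.2
  end.

Let single_addr_size x : size (single_addr x) <= h.
Proof.
case: x => -[u i] b; rewrite /single_addr /= size_cat size_nseq.
by have := size_bseq u; have := ltn_ord i; rewrite /m; lia.
Qed.

Let is_path_family i : is_path (family i).
Proof.
case: i => [v|x] /=; last exact/is_path_single/single_addr_size.
by apply: is_path_zigzag; rewrite ltnW // ltnS size_bseq.
Qed.

(** The edges above the blocks, and those that are reached from the root of a block
    by a constant run of bits. *)
Let special s := exists x, s = single_addr x.

(** All other edges are the intersection of two zigzag paths of their block. *)
Let crossing s := exists w1 w2 : {bseq h' of bool},
  [/\ m <= size w1, m <= size w2 & size w1 != size w2] /\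
  [/\ block w1 = block s, block w2 = block s, on (zigzag h w1) s, on (zigzag h w2) s &
    forall t, t != [::] -> size t <= h ->
      on (zigzag h w1) t -> on (zigzag h w2) t -> t = s].

Let block_cat u w : m <= size w -> block (u ++ w) = block w.
Proof.
move=> mw; rewrite /block size_cat -addnBA // drop_cat ifN ?addKn //.
by rewrite -leqNgt leq_addr.
Qed.

(** If the position y in the block is not constant, then its first run, at the lower
    end, is followed by another bit b of y, and the zigzag path that turns just above
    this bit is in the block, too. *)
Let special_or_crossing s : s != [::] -> size s <= h -> special s \/ crossing s.
Proof.
move=> s0 sh; case: (leqP (size s) m) => [sm|ms].
  by left; exists (Bseq sm, ord0, true).
pose y := take (size s - m) s; pose u := block s.
have um : size u <= m by rewrite size_drop; lia.
have sE : s = y ++ u by rewrite cat_take_drop.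
have szy : size y = size s - m by rewrite size_takel // leq_subr.
case: (run_split y) => [[c yE]|[j [b [v yE]]]]; [left|right].
  have yD : size y < D.+1 by rewrite szy /m; lia.
  by exists (Bseq um, Ordinal yD, c); rewrite /single_addr /= -yE.
have szu : size u = m by rewrite /u /block size_drop subKn // ltnW.
pose w := nseq j (~~ b) ++ b :: (v ++ u).
have sw : s = ~~ b :: w by rewrite sE yE /w -catA.
have wh : size w <= h' by move: sh; rewrite sw.
have vw : size (v ++ u) < size w by rewrite /w [ltnRHS]size_cat /= ltn_addl.
have vh : size (v ++ u) <= h' by rewrite ltnW // (leq_trans vw).
have mv : m <= size (v ++ u) by rewrite size_cat szu leq_addl.
exists (Bseq wh), (Bseq vh); split; split=> /=.
- by rewrite ltnW // (leq_ltn_trans mv).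
- exact: mv.
- by rewrite gtn_eqF.
- by rewrite sw -cat1s block_cat // ltnW // (leq_ltn_trans mv).
- have -> : s = (~~ b :: rcons (nseq j (~~ b)) b) ++ v ++ u by rewrite sw /w -cat_rcons.
  by rewrite [RHS]block_cat.
- by apply/on_zigzagP => //; exists 0, (~~ b).
- by apply/on_zigzagP => //; exists j.+1, b; rewrite sw.
- by move=> t t0 th wt vt; rewrite sw; apply: zigzag_meet wt vt.
Qed.

Let on_block (w : {bseq h' of bool}) s : s != [::] -> size s <= h -> m <= size w ->
  on (zigzag h w) s -> block s = block w.
Proof.
move=> s0 sh mw; case/on_zigzagP=> //; first by rewrite ltnS size_bseq.
by move=> j [b ->]; rewrite -cat_rcons block_cat.
Qed.

Let color_val (w : {bseq h' of bool}) :
  val (insub_bseq D (take (size w - m) w)) = take (size w - m) w.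
Proof.
have sz : size (take (size w - m) w) <= D.
  by rewrite size_takel ?leq_subr //; have := size_bseq w; have := Dh; rewrite /m /h; lia.
by rewrite insubdK.
Qed.

Let color_inj (w1 w2 : {bseq h' of bool}) : m <= size w1 -> m <= size w2 ->
  block w1 = block w2 -> color (inl w1) = color (inl w2) -> w1 = w2.
Proof.
move=> m1 m2 b12 [] /(congr1 val); rewrite !color_val => t12.
by apply: val_inj; rewrite /= -(cat_take_drop (size w1 - m) w1) t12 -/(block w1) b12 cat_take_drop.
Qed.

Let color_size (w1 w2 : {bseq h' of bool}) : m <= size w1 -> m <= size w2 ->
  size w1 != size w2 -> color (inl w1) <> color (inl w2).
Proof.
move=> m1 m2 /eqP ne [] /(congr1 val); rewrite !color_val => /(congr1 size).
by rewrite !size_takel ?leq_subr // => e; apply: ne; lia.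
Qed.

Let separated s t := exists i j,
  [/\ color i <> color j, on (family i) s /\ ~~ on (family i) t &
      on (family j) t /\ ~~ on (family j) s].

Let crossing_avoids s t : t != [::] -> size t <= h -> s <> t -> crossing s ->
  exists w : {bseq h' of bool}, [/\ m <= size w, block w = block s,
    on (zigzag h w) s & ~~ on (zigzag h w) t].
Proof.
move=> t0 th st [w1 [w2 [[m1 m2 _] [b1 b2 o1 o2 meet]]]].
case o1t: (on (zigzag h w1) t); last by exists w1; rewrite o1t.
exists w2; split=> //; apply/negP => o2t.
by apply: st; rewrite (meet t).
Qed.

Let special_crossing s t : s != [::] -> size s <= h -> t != [::] -> size t <= h ->
  s <> t -> special s -> crossing t -> separated s t.
Proof.
move=> s0 sh t0 th st [x sx] /(crossing_avoids s0 sh (not_eq_sym st))[w [_ _ wt ws]].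
exists (inr (x, true)), (inl w); split=> //=; rewrite -sx !on_single // eqxx.
by split=> //; apply/eqP => /esym.
Qed.

(** In one block, different zigzag paths have different colours. Between two blocks,
    any path through s avoids t and vice versa, and one of the two paths through t
    has another colour than the chosen path through s. *)
Let crossing_crossing s t : s != [::] -> size s <= h -> t != [::] -> size t <= h ->
  s <> t -> crossing s -> crossing t -> separated s t.
Proof.
move=> s0 sh t0 th st cs ct.
have [w [mw bw ws wt]] := crossing_avoids t0 th st cs.
have [bst|bst] := eqVneq (block s) (block t).
  have [z [mz bz zt zs]] := crossing_avoids s0 sh (not_eq_sym st) ct.
  exists (inl w), (inl z); split=> //= cwz.
  by move: zs; rewrite -(@color_inj w z) ?ws // bw bz.
have [z1 [z2 [[m1 m2 z12] [b1 b2 o1 o2 _]]]] := ct.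
have off (z : {bseq h' of bool}) : m <= size z -> block z = block t -> ~~ on (zigzag h z) s.
  by move=> mz bz; apply: contraNN bst => /(on_block s0 sh mz) ->; rewrite bz.
case: (eqVneq (color (inl w)) (color (inl z1))) => [cw|/eqP cw]; last first.
  by exists (inl w), (inl z1); split=> //=; split=> //; apply: off.
exists (inl w), (inl z2); split=> //; last by split=> //; apply: off.
by rewrite cw; apply: color_size.
Qed.

Let all_separated s t : s != [::] -> size s <= h -> t != [::] -> size t <= h ->
  s <> t -> separated s t.
Proof.
move=> s0 sh t0 th st.
case: (special_or_crossing s0 sh) => [ss|cs]; case: (special_or_crossing t0 th) => [sp|cp].
- have [[x sx] [y ty]] := (ss, sp).
  exists (inr (x, true)), (inr (y, false)); split=> //=; rewrite -?sx -?ty !on_single //.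
    by rewrite eqxx; split=> //; apply/eqP => /esym.
  by rewrite eqxx; split=> //; apply/eqP.
- exact: special_crossing.
- have [i [j [cij si tj]]] := special_crossing t0 th s0 sh (not_eq_sym st) sp cs.
  by exists j, i; split=> // /esym.
- exact: crossing_crossing.
Qed.

Lemma card_bseq_bool n : #|{: {bseq n of bool}}| = (2 ^ n.+1).-1.
Proof. exact: (card_bintree n). Qed.

(** The palette consists of the 2^(D+1) - 1 positions in a block and two more colours;
    there are 2^h - 1 zigzag paths and 4 (D+1) (2^(h-D+1) - 1) single-edge paths. *)
Lemma sep_number_bintree_le :
  sep_number (Some (2 ^ D.+1).+1) (bintree h) <= 2 ^ h + 8 * D.+1 * 2 ^ (h - D).
Proof.
have cardC : #|{: bool + {bseq D of bool}}| = (2 ^ D.+1).+1.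
  by rewrite card_sum card_bool card_bseq_bool; have := expn_gt0 2 D.+1; lia.
rewrite -cardC; apply: leq_trans (_ : #|index| <= _).
  apply: (sep_number_Some_le (col := color) _ is_path_family).
    by rewrite cardC; have := expn_gt0 2 D.+1; lia.
  move=> e f /edges_edge[s [s0 sh ->]] /edges_edge[t [t0 th ->]] ef.
  by apply: all_separated => // st; apply: ef; rewrite st.
rewrite card_sum !card_prod !card_bseq_bool card_ord !card_bool -/h -/m expnS.
by have := expn_gt0 2 m; have := expn_gt0 2 h; nia.
Qed.
End UpperBound.

(** * The separation ratios of complete binary trees *)

Lemma two_edges_bintree h : 0 < h -> 2 <= #|edges (bintree h)|.
Proof.
move=> h0; apply/card_gt1P; exists (edge h [:: false]), (edge h [:: true]).
split; try exact: edge_edges.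
by apply/eqP => /edge_inj; case/(_ isT isT h0 h0).
Qed.

Lemma sep_number_None_ge h : 0 < h -> 2 ^ h <= sep_number None (bintree h).
Proof.
move=> h0; have [S [sS <-]] := sep_number_strong (bintree h).
exact: strong_sep_card sS.
Qed.

Lemma ratio_bintree_le D h : 0 < h -> D <= h ->
  2 ^ D * sep_number (Some (2 ^ D.+1).+1) (bintree h) <=
  (2 ^ D + 8 * D.+1) * sep_number None (bintree h).
Proof.
case: h => // h h0 Dh; apply: leq_trans (leq_mul (leqnn _) (sep_number_None_ge h0)).
apply: leq_trans (leq_mul (leqnn _) (sep_number_bintree_le Dh)) _.
by rewrite mulnDr mulnDl leq_add2l mulnCA -expnD subnKC.
Qed.

Lemma pow_slack t : 8 * (2 * t).+1 * 2 ^ t <= 16 * 2 ^ (2 * t).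
Proof.
have : (2 * t).+1 <= 2 * 2 ^ t by have := ltn_expl t (ltnSn 1); lia.
by rewrite mul2n -addnn expnD; nia.
Qed.

(** With x = 2^h / a, [rainbow_card] says that there are at least (a + 2) x - (k + 1)
    paths, and k + 1 is at most x. A rainbow system for blocks of height D shows that
    the strong separation number is at most (a + 1/4) x, and D = 2 (k + 8) makes
    D / 2^D small enough for this. *)
Lemma ratio_bintree_ge k h : 2 <= k -> 2 * (k + 8) <= h ->
  let a := 2 ^ (k + 2) in
  (4 * a + 4) * sep_number None (bintree h) <=
  (4 * a + 1) * sep_number (Some k) (bintree h).
Proof.
move=> k2 kh; have h0 : 0 < h by lia.
move aE : (2 ^ (k + 2)) => a /=.
have [P [isp [col sepP]]] := sep_number_rsps (bintree h) k2.
have kh' : k <= h by lia.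
have := rainbow_card h0 isp sepP kh'.
set c := sep_number (Some k) _ => low.
have hE : 2 ^ h = a * 2 ^ (h - k - 2) by rewrite -aE -expnD; congr (2 ^ _); lia.
have hkE : 2 ^ (h - k) = 4 * 2 ^ (h - k - 2).
  by rewrite -[4]/(2 ^ 2) -expnD; congr (2 ^ _); lia.
have slack : 2 * k.+1 <= 2 * 2 ^ (h - k - 2).
  have : k.+1 <= 2 ^ k.+1 by rewrite ltnW // ltn_expl.
  have : 2 ^ k.+1 <= 2 ^ (h - k - 2) by rewrite leq_exp2l //; lia.
  by lia.
have {}low : (a + 1) * 2 ^ (h - k - 2) <= c by nia.
set D := 2 * (k + 8).
have up : sep_number None (bintree h) <= 2 ^ h + 8 * D.+1 * 2 ^ (h - D).
  case: (h) h0 kh {low slack hkE hE kh' sepP P isp c col} => // h1 _ Dh.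
  apply: leq_trans (sep_number_bintree_le Dh); apply: sep_number_None_Some.
  by rewrite ltnS expn_gt0.
have {}up : 4 * sep_number None (bintree h) <= (4 * a + 1) * 2 ^ (h - k - 2).
  have small : 4 * (8 * D.+1 * 2 ^ (h - D)) <= 2 ^ (h - k - 2).
    have := pow_slack (k + 8); rewrite -/D => sl.
    rewrite -(leq_pmul2r (_ : 0 < 2 ^ (k + 8))) ?expn_gt0 //.
    apply: leq_trans (_ : 4 * 2 ^ (h - D) * (16 * 2 ^ D) <= _); first by nia.
    rewrite -[4]/(2 ^ 2) -[16]/(2 ^ 4) -!expnD leq_exp2l //; lia.
  by nia.
apply: leq_trans (_ : (a + 1) * ((4 * a + 1) * 2 ^ (h - k - 2)) <= _).
  by rewrite (_ : 4 * a + 4 = (a + 1) * 4) -?mulnA ?leq_mul2l ?up ?orbT //; lia.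
by rewrite mulnCA leq_mul2l low orbT.
Qed.

Section Ratio.
Variable R : realType.
Local Open Scope ring_scope.

Lemma class_ratio_le k (c : R) (n : nat) :
  (forall G, BT G -> (n <= #|G|)%N -> sep_ratio R k G <= c) ->
  (class_ratio R k BT <= c%:E)%E.
Proof.
move=> rc; apply: ereal_inf_le; exists (ereal_sup [set x | exists G,
  [/\ BT G, (2 <= #|edges G|)%N, (n <= #|G|)%N & x = (sep_ratio R k G)%:E]]%classic).
  by exists n.
by apply: ge_ereal_sup => _ [G [BG _ nG ->]]; rewrite lee_fin; apply: rc.
Qed.

Lemma class_ratio_ge k (c : R) :
  (forall n : nat, exists h, [/\ (0 < h)%N, (n <= #|bintree h|)%N &
     c <= sep_ratio R k (bintree h)]) ->
  (c%:E <= class_ratio R k BT)%E.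
Proof.
move=> rc; apply: le_ereal_inf_tmp => _ [n _ <-].
have [h [h0 nh ch]] := rc n.
apply: le_trans (_ : (sep_ratio R k (bintree h))%:E <= _)%E; first by rewrite lee_fin.
apply: ereal_sup_ubound; exists (bintree h); split=> //.
  exact: bintree_BT.
exact: two_edges_bintree.
Qed.

Lemma sep_ratio_iso k (G H : sgraph) (f : G -> H) :
  graph_iso f -> sep_ratio R k G = sep_ratio R k H.
Proof. by move=> isof; rewrite /sep_ratio !(sep_number_iso _ isof). Qed.

Lemma sep_number_None_gt0 h : (0 < h)%N ->
  0 < (sep_number None (bintree h))%:R :> R.
Proof.
move=> h0; rewrite ltr0n; apply: leq_trans (sep_number_None_ge h0).
by rewrite expn_gt0.
Qed.

Lemma large_bintree (n h : nat) : (n <= h)%N -> (n <= #|bintree h|)%N.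
Proof. by move=> nh; rewrite card_bintree; have := ltn_expl h.+1 (ltnSn 1); lia. Qed.

Lemma class_ratio_None : class_ratio R None BT = 1%E.
Proof.
have one h : (0 < h)%N -> sep_ratio R None (bintree h) = 1.
  by move=> h0; rewrite /sep_ratio divff // gt_eqF // sep_number_None_gt0.
apply/eqP; rewrite eq_le; apply/andP; split.
  apply: (@class_ratio_le _ _ 0) => G /BT_iso[d [d0 [f isof]]] _.
  by rewrite -(sep_ratio_iso _ isof) one.
apply: class_ratio_ge => n; exists n.+1; split=> //; last by rewrite one.
exact/large_bintree/leqnSn.
Qed.

Lemma class_ratio_Some_gt1 (k : nat) : (2 <= k)%N -> (1 < class_ratio R (Some k) BT)%E.
Proof.
move=> k2; pose a := (2 ^ (k + 2))%N.
have den0 : (0 : R) < (4 * a + 1)%:R by rewrite ltr0n addn1.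
apply: lt_le_trans (_ : ((4 * a + 4)%:R / (4 * a + 1)%:R)%:E <= _)%E.
  rewrite lte_fin ltr_pdivlMr // mul1r ltr_nat; lia.
apply: class_ratio_ge => n; exists (n + 2 * (k + 8))%N.
have h0 : (0 < n + 2 * (k + 8))%N by lia.
split=> //; first by apply: large_bintree; lia.
rewrite /sep_ratio ler_pdivlMr ?sep_number_None_gt0 // mulrAC ler_pdivrMr //.
rewrite -!natrM ler_nat [leqRHS]mulnC.
by apply: ratio_bintree_ge => //; lia.
Qed.

Lemma rainbow_separable_BT : rainbow_separable R BT.
Proof.
move=> eps eps0; pose t := Num.bound (32%:R / eps); pose D := (2 * t)%N.
(* By [pow_slack], 8 (D + 1) / 2^D is at most 16 / 2^t, which is below eps / 2. *)
exists (2 ^ D.+1).+1; split; first by rewrite ltnS expn_gt0.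
apply: le_lt_trans (_ : _ <= (1 + eps / 2%:R)%:E)%E _; last first.
  by rewrite lte_fin ltrD2l ltr_pdivrMr // ltr_pMr // ltr1n.
apply: (@class_ratio_le _ _ (2 ^ D.+1)) => G /BT_iso[d [d0 [f isof]]].
rewrite -(card_iso isof) -(sep_ratio_iso _ isof) card_bintree => Dd.
have {}Dd : (D <= d)%N.
  rewrite leqNgt; apply/negP => dD.
  have : (2 ^ d.+1 <= 2 ^ D)%N by rewrite leq_exp2l.
  have : (2 ^ D < 2 ^ D.+1)%N by rewrite ltn_exp2l.
  by lia.
have c0 := sep_number_None_gt0 d0; have p0 : (0 : R) < (2 ^ t)%:R by rewrite ltr0n expn_gt0.
have pD : (0 : R) < (2 ^ D)%:R by rewrite ltr0n expn_gt0.
rewrite /sep_ratio ler_pdivrMr //.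
have := ratio_bintree_le d0 Dd; rewrite -(ler_nat R) !natrM natrD => ratio.
have slack : (8 * D.+1)%:R <= eps / 2%:R * (2 ^ D)%:R :> R.
  have := pow_slack t; rewrite -/D -(ler_nat R) !natrM => sl.
  have te : 32%:R < eps * (2 ^ t)%:R :> R.
    rewrite mulrC -ltr_pdivrMr //; apply: lt_trans (archi_boundP _) _.
      by rewrite divr_ge0 // ltW.
    by rewrite ltr_nat ltn_expl.
  rewrite -(ler_pM2r p0); nra.
rewrite -(ler_pM2l pD); apply: le_trans ratio _; rewrite mulrA ler_pM2r //.
by rewrite mulrDr mulr1 lerD2l mulrC.
Qed.
End Ratio.

Theorem theorem4p5 (R : realType) :
  [/\ chi_rs R BT = None,
      rainbow_separable R BT &
      forall k : nat, (2 <= k)%N -> class_ratio R (Some k) BT <> 1%E].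
Proof.
have finite_ne1 k : (2 <= k)%N -> class_ratio R (Some k) BT <> 1%E.
  by move=> k2; apply/eqP; rewrite gt_eqF // class_ratio_Some_gt1.
split=> //; last exact: rainbow_separable_BT.
apply: xget_unique.
  split=> //; first exact: class_ratio_None.
  by case=> // k k2 /(finite_ne1 k k2).
by case=> // k [k2 /(finite_ne1 k k2)].
Qed.
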